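(* Let $I\subset S$ be a Borel fixed ideal all of whose minimal monomial generators have degree at most $d$, and $\widetilde I=\operatorname{b-pol}(I)$. Then the description of the resolution $\widetilde P_\bullet$ coincides with the Batzies–Welker type resolution $\widetilde Q_\bullet$; more precisely, the truncation $\widetilde P_{\ge1}$ coincides with $\widetilde Q_\bullet$: the $\widetilde S$-isomorphisms $\widetilde Q_q\to\widetilde P_{q+1}$ ($q\ge0$) given by $e(\sigma)\mapsto e(\widetilde F_\sigma,\widetilde m_\sigma)$ form an isomorphism of chain complexes $\widetilde Q_\bullet\cong\widetilde P_{\ge1}$.
   Context: Let $\Bbbk$ be a field and $S=\Bbbk[x_1,\dots,x_n]$. For a monomial ideal $J$, $G(J)$ denotes its set of minimal monomial generators. A monomial ideal $I\subset S$ is Borel fixed (strongly stable) if $m\in G(I)$, $x_i\mid m$ and $j<i$ imply $(x_j/x_i)\,m\in I$. Fix such an $I$ and an integer $d$ with $\deg m\le d$ for all $m\in G(I)$. Let $\widetilde S=\Bbbk[x_{i,j}\mid 1\le i\le n,\ 1\le j\le d]$. A monomial $m\in S$ of degree $e\le d$ is written uniquely as $m=\prod_{i=1}^e x_{\alpha_i}$ with $\alpha_1\le\cdots\le\alpha_e$; set $\widetilde m=\operatorname{b-pol}(m):=\prod_{i=1}^e x_{\alpha_i,i}\in\widetilde S$, and $\widetilde I=\operatorname{b-pol}(I):=(\widetilde m\mid m\in G(I))\subset \widetilde S$, so $G(\widetilde I)=\{\widetilde m\mid m\in G(I)\}$. For a monomial $m$ let $\mu(m)=\min\{i: x_i\mid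 m\}$ and $\nu(m)=\max\{i: x_i\mid m\}$ (with $\mu(1)=\infty$). Every monomial $m\in I$ has a unique expression $m=m_1m_2$ with $\nu(m_1)\le\mu(m_2)$ and $m_1\in G(I)$; put $g(m):=m_1$. For a monomial $m=\prod x_l^{a_l}$ and $i<\nu(m)$ put $\mathfrak b_i(m):=(x_i/x_k)\,m$ with $k=\min\{j>i: a_j>0\}$. For $m\in G(I)$ put $m_{\langle i\rangle}:=g(\mathfrak b_i(m))$ if $1\le i<\nu(m)$, $m_{\langle i\rangle}:=m$ if $i\ge\nu(m)$, and $\widetilde m_{\langle i\rangle}:=\operatorname{b-pol}(m_{\langle i\rangle})$. Admissible pairs and $\widetilde P_\bullet$: for a finite set $\widetilde F=\{(i_1,j_1),\dots,(i_q,j_q)\}\subset\mathbb N\times\mathbb N$ and $m=\prod x_l^{a_l}\in G(I)$, the pair $(\widetilde F,\widetilde m)$ is admissible if (a) $1\le i_1<\cdots<i_q<\nu(m)$ and (b) $j_r=1+\sum_{l=1}^{i_r}a_l$ for all $r$; $(\emptyset,\widetilde m)$ is also admissible. Put $\widetilde F_r:=\widetilde F\setminus\{(i_r,j_r)\}$ and $B(\widetilde F,\widetilde m):=\{r\mid (\widetilde F_r,\widetilde m_{\langle i_r\rangle})\text{ is admissible}\}$. $\widetilde P_0=\widetilde S$, and for $q\ge1$, $\widetilde P_q=\bigoplus \widetilde S\,e(\widetilde F,\widetilde m)$ over admissible pairs with $\#\widetilde F=q-1$. The differential $\partial:\widetilde P_{q+1}\to\widetilde P_q$ ($q\ge1$)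 sends $e(\widetilde F,\widetilde m)$, $\widetilde F=\{(i_1,j_1),\dots,(i_q,j_q)\}$, to $$\sum_{1\le r\le q}(-1)^r x_{i_r,j_r}\,e(\widetilde F_r,\widetilde m)-\sum_{r\in B(\widetilde F,\widetilde m)}(-1)^r\frac{x_{i_r,j_r}\,\widetilde m}{\widetilde m_{\langle i_r\rangle}}\,e(\widetilde F_r,\widetilde m_{\langle i_r\rangle}),$$ and $\partial:\widetilde P_1\to\widetilde P_0$ sends $e(\emptyset,\widetilde m)$ to $\widetilde m$. The matching: let $\sqsubset$ be the total order on $G(\widetilde I)$ with $\widetilde m'\sqsubset\widetilde m$ iff $m'\succ m$ in the lexicographic order on monomials of $S$ with $x_1\succ\cdots\succ x_n$. For $\emptyset\ne\sigma\subset G(\widetilde I)$ let $\widetilde m_\sigma$ (with $m_\sigma\in G(I)$) be the $\sqsubset$-largest element of $\sigma$, $\operatorname{lcm}(\sigma)$ the lcm of the elements of $\sigma$, $(\widetilde m_\sigma)_{\langle i\rangle}:=\operatorname{b-pol}((m_\sigma)_{\langle i\rangle})$, and $N_\sigma:=\{(\widetilde m_\sigma)_{\langle i\rangle}\mid 1\le i<\nu(m_\sigma),\ (\widetilde m_\sigma)_{\langle i\rangle}\text{ divides }\operatorname{lcm}(\sigma)\}$. Let $\prec_\sigma$ be the total order on $G(\widetilde I)$ in which every element of $N_\sigma$ precedes every element of $G(\widetilde I)\setminus N_\sigma$ and which agrees with $\sqsubset$ on $N_\sigma$ and on $G(\widetilde I)\setminus N_\sigma$. Write $\sigma=\{\widetilde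 m_1\prec_\sigma\cdots\prec_\sigma\widetilde m_k\}$ (then $\widetilde m_k=\widetilde m_\sigma$), for $1\le l<k$ put $\sigma_l:=\{\widetilde m_{k-l},\dots,\widetilde m_k\}$, and $$u(\sigma):=\sup\{l\mid \exists\,\widetilde m\in G(\widetilde I)\text{ with }\widetilde m\prec_\sigma\widetilde m_{k-l}\text{ and }\widetilde m\mid\operatorname{lcm}(\sigma_l)\}$$ ($\sup\emptyset=-\infty$). If $u:=u(\sigma)\neq-\infty$, let $\widetilde n_\sigma$ be the $\prec_\sigma$-minimum of $\{\widetilde m\in G(\widetilde I)\mid\widetilde m\text{ divides }\operatorname{lcm}(\sigma_u)\}$. Let $G_X$ be the directed graph on the nonempty subsets of $G(\widetilde I)$ with an edge $\sigma\to\sigma'$ iff $\sigma\supset\sigma'$ and $\#\sigma=\#\sigma'+1$; $E_X$ its edge set; and $A:=\{\sigma\cup\{\widetilde n_\sigma\}\to\sigma\mid u(\sigma)\ne-\infty,\ \widetilde n_\sigma\notin\sigma\}$. $A$ is an acyclic matching (Batzies–Welker). Let $G_X^A$ have the same vertices and edge set $(E_X\setminus A)\cup\{\sigma\to\tau\mid(\tau\to\sigma)\in A\}$. A directed path in $G_X^A$ (length $0$ allowed) is a gradient path. A nonempty $\sigma$ is critical if it occurs in no edge of $A$. Critical sets with $q+1$ elements are exactly the sets $\sigma=\{(\widetilde m_\sigma)_{\langle i_r\rangle}\mid1\le r\le q\}\cup\{\widetilde m_\sigma\}$ with $1\le i_1<\cdots<i_q<\nu(m_\sigma)$; writing $m_\sigma=\prod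 x_l^{a_l}$, $j_r=1+\sum_{l=1}^{i_r}a_l$ and $\widetilde F_\sigma=\{(i_1,j_1),\dots,(i_q,j_q)\}$, the map $\sigma\mapsto(\widetilde F_\sigma,\widetilde m_\sigma)$ is a bijection from critical sets to admissible pairs. The complex $\widetilde Q_\bullet$ (a minimal free resolution of $\widetilde I$, by Batzies–Welker): $\widetilde Q_q=\bigoplus\widetilde S\,e(\sigma)$ over critical $\sigma$ with $\#\sigma=q+1$ ($q\ge0$), with $e(\sigma)$ of degree $\deg\operatorname{lcm}(\sigma)$; for $\sigma$ as displayed with $q\ge1$ the differential sends $e(\sigma)$ to $$\sum_{r=1}^q(-1)^r x_{i_r,j_r}\,e(\sigma\setminus\{(\widetilde m_\sigma)_{\langle i_r\rangle}\})-(-1)^q\sum_{\tau,\mathcal P}m(\mathcal P)\,\frac{\operatorname{lcm}(\sigma)}{\operatorname{lcm}(\tau)}\,e(\tau),$$ the last sum over critical $\tau$ with $\#\tau=\#\sigma-1$ and gradient paths $\mathcal P$ from $\sigma\setminus\{\widetilde m_\sigma\}$ to $\tau$. Here, for $\rho=\{\widetilde m_1\sqsubset\cdots\sqsubset\widetilde m_{p}\}$ and $\rho'=\rho\setminus\{\widetilde m_r\}$, $[\rho:\rho']:=(-1)^r$, and for $\mathcal P=(\sigma_0\to\cdots\to\sigma_l)$, $$m(\mathcal P)=\prod_{\substack{1\le i\le l\\(\sigma_i\to\sigma_{i-1})\notin A}}[\sigma_{i-1}:\sigma_i]\cdot\prod_{\substack{1\le i\le l\\(\sigma_i\to\sigma_{i-1})\in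 A}}(-[\sigma_i:\sigma_{i-1}]).$$ *)

(* Defs.v *)
From HB Require Import structures.
From mathcomp Require Import all_boot all_order all_algebra.
From mathcomp Require Import mpoly.

Set Implicit Arguments.
Unset Strict Implicit.
Unset Printing Implicit Defensive.

Import GRing.Theory.
Local Open Scope ring_scope.

(* Conventions.  Variables of S are indexed by 'I_n and variables x_{i,j} of
   the polarized ring by 'I_n * 'I_d, both 0-based; ranks and the values of
   nu and mu are 1-based, so that "i < nu(m)" reads i.+1 < nu m.             *)

Section FreeModule.
Context {R : comNzRingType} {T : finType} {V : lmodType R}.

Definition linext (f : T -> V) (u : {ffun T -> R^o}) : V :=
  \sum_(t : T) (u t : R) *: f t.

Fact linext_is_linear f : linear (linext f).
Proof.
move=> a u v; rewrite /linext scaler_sumr -big_split; apply: eq_bigr => t _.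
by rewrite !ffunE scalerDl -scalerA.
Qed.

HB.instance Definition _ f :=
  GRing.isLinear.Build R {ffun T -> R^o} V _ (linext f) (linext_is_linear f).
End FreeModule.

(* The basis vector e(x) of the free module on {y | P y}, with the convention
   e(x) = 0 when x is not an index. *)
Definition basisv {R : nzRingType} {T : finType} {P : pred T} (x : T) :
    {ffun {y : T | P y} -> R^o} :=
  [ffun y => ((val y == x)%:R : R)].

Section Complexes.
Context {R : nzRingType}.

Definition is_complex (C : nat -> lmodType R)
    (dC : forall q, {linear C q.+1 -> C q}) : Prop :=
  forall q x, dC q (dC q.+1 x) = 0.

Definition is_complex_iso (C D : nat -> lmodType R)
    (dC : forall q, {linear C q.+1 -> C q})
    (dD : forall q, {linear D q.+1 -> D q})
    (f : forall q, {linear C q -> D q}) : Prop :=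
  [/\ is_complex dC,
      is_complex dD,
      forall q, bijective (f q)
    & forall q x, f q (dC q x) = dD q (f q.+1 x)].
End Complexes.

Section Monomials.
Context {n : nat}.
Implicit Types m : 'X_{1..n}.

(* nu 1 = 0, and n.+1 plays the role of mu 1 = oo. *)
Definition nu m : nat := \max_(i < n | (0 < m i)%N) i.+1.
Definition mu m : nat := \big[minn/n.+1]_(i < n | (0 < m i)%N) i.+1.

Definition lexgt m m' : bool :=
  [exists i : 'I_n,
     (m' i < m i)%N && [forall j : 'I_n, (j < i)%N ==> (m j == m' j)]].

(* The monomial b_i(m), meaningful when i.+1 < nu m. *)
Definition borel_step m (i : 'I_n) : 'X_{1..n} :=
  let k := [arg min_(j < i | (i < j)%N && (0 < m j)%N) (j : nat)] in
  (m - U_(k) + U_(i))%MM.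

(* a_1 + ... + a_i; the j_r of an admissible pair, in 0-based form. *)
Definition partial_deg m (i : 'I_n) : nat := (\sum_(l < n | l <= i) m l)%N.

(* The sequence alpha_1 <= ... <= alpha_e such that m = \prod x_{alpha_i}. *)
Definition factors m : seq 'I_n :=
  flatten [seq nseq (m i) i | i <- enum 'I_n].
End Monomials.

Section BPol.
Context {n : nat} (d : nat).
Implicit Types m : 'X_{1..n}.

Definition pvar (p : 'I_n * 'I_d) : 'X_{1..n * d} := U_(mxvec_index p.1 p.2)%MM.

Definition bpol m : 'X_{1..n * d} :=
  (\sum_(p : 'I_n * 'I_d | onth (factors m) p.2 == Some p.1) pvar p)%MM.
End BPol.

Section Ideal.
Context {k : fieldType} {n : nat} (I : {pred {mpoly k[n]}}).
Implicit Types m : 'X_{1..n}.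

Definition monomial_ideal : Prop :=
  exists M : 'X_{1..n} -> Prop, forall p : {mpoly k[n]},
    p \in I <->
    exists2 s : seq ({mpoly k[n]} * 'X_{1..n}),
      (forall a, a \in s -> M a.2) & p = \sum_(a <- s) a.1 * 'X_[a.2].

Definition mingen m : bool :=
  ('X_[m] \in I) &&
  [forall m' : 'X_{1..n < (mdeg m).+1},
     (m' <= m)%MM && ('X_[m'] \in I) ==> (m' == m :> 'X_{1..n})].

Definition borel_fixed : Prop :=
  monomial_ideal /\
  forall m (i j : 'I_n), mingen m -> (0 < m i)%N -> (j < i)%N ->
    'X_[m - U_(i) + U_(j)] \in I.
End Ideal.

Section Resolutions.
Context {k : fieldType} {n : nat} (I : {pred {mpoly k[n]}}) (d : nat).

(* Under the standing assumption that minimal generators have degree <= d,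
   the set [gens] is G(I).  Since bpol is injective on monomials of degree
   <= d, subsets of G(bpol I) are represented by subsets of G(I). *)
Local Notation mon := 'X_{1..n < d.+1}.
Local Notation vertex := {set mon}.
Local Notation St := {mpoly k[n * d]}.

Definition gens : {set mon} := [set m : mon | mingen I m].

Definition gpart (m : 'X_{1..n}) : mon :=
  odflt bm0 [pick m1 : mon |
    [&& m1 \in gens, (m1 <= m)%MM & (nu m1 <= mu (m - m1)%MM)%N]].

Definition bracket (m : mon) (i : 'I_n) : mon :=
  if (i.+1 < nu m)%N then gpart (borel_step m i) else m.

(* Condition (b) forces the first components of F to be pairwise distinct. *)
Definition admissible (F : {set 'I_n * 'I_d}) (m : mon) : bool :=
  (m \in gens) &&
  [forall p in F, (p.1.+1 < nu m)%N && (p.2 == partial_deg m p.1 :> nat)].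

(* The index r of p = (i_r, j_r) in F. *)
Definition frank (F : {set 'I_n * 'I_d}) (p : 'I_n * 'I_d) : nat :=
  #|[set p' in F | (p'.1 <= p.1)%N]|.

Definition Pidx q : pred ({set 'I_n * 'I_d} * mon) :=
  fun x => admissible x.1 x.2 && (#|x.1| == q).

Definition Pmod (q : nat) : lmodType St :=
  if q is q'.+1 then {ffun {x | Pidx q' x} -> St^o} else St^o.

(* Quotients of monomials are differences of exponents, here and in Qdiff_val;
   the differences are never truncated on the indices of the sums. *)
Definition Pdiff_val q (x : {set 'I_n * 'I_d} * mon) : Pmod q.+1 :=
  let: (F, m) := x in
  \sum_(p in F) ((-1) ^+ frank F p * 'X_[pvar p]) *: basisv (F :\ p, m)
  - \sum_(p in F | admissible (F :\ p) (bracket m p.1))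
      ((-1) ^+ frank F p * 'X_[pvar p + bpol d m - bpol d (bracket m p.1)])
        *: basisv (F :\ p, bracket m p.1).

Definition Pdiff (q : nat) : {linear Pmod q.+1 -> Pmod q} :=
  match q return {linear Pmod q.+1 -> Pmod q} with
  | 0 => linext (fun x : {x | Pidx 0 x} => 'X_[bpol d (val x).2] : St^o)
  | q'.+1 => linext (fun x : {x | Pidx q'.+1 x} => Pdiff_val q' (val x))
  end.

Definition before (m' m : mon) : bool := lexgt m' m.

Definition top (s : vertex) : mon :=
  odflt bm0 [pick m in s | [forall m' in s, (m' == m) || before m' m]].

Definition lcmset (s : vertex) : 'X_{1..n * d} :=
  \big[@mlcm _/0%MM]_(m in s) bpol d m.

Definition Nset (s : vertex) : {set mon} :=
  [set bracket (top s) i | i : 'I_n &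
     (i.+1 < nu (top s))%N && (bpol d (bracket (top s) i) <= lcmset s)%MM].

Definition sbefore (s : vertex) (m' m : mon) : bool :=
  if (m' \in Nset s) == (m \in Nset s) then before m' m else m' \in Nset s.

(* m_1, ..., m_k in increasing order for the order attached to s. *)
Definition senum (s : vertex) : seq mon :=
  sort (fun m' m => (m' == m) || sbefore s m' m) (enum s).

(* m_{k-l} *)
Definition selem (s : vertex) (l : nat) : mon :=
  nth bm0 (senum s) (#|s| - l.+1).

(* {m_{k-l}, ..., m_k} *)
Definition stail (s : vertex) (l : nat) : vertex :=
  [set m in drop (#|s| - l.+1) (senum s)].

(* As l ranges over positive numbers, the value 0 stands for -oo. *)
Definition uval (s : vertex) : nat :=
  \max_(1 <= l < #|s| | [exists m in gens,
      sbefore s m (selem s l) && (bpol d m <= lcmset (stail s l))%MM]) l.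

Definition nmin (s : vertex) : mon :=
  let D := [set m in gens | (bpol d m <= lcmset (stail s (uval s)))%MM] in
  odflt bm0 [pick m in D | [forall m' in D, (m' == m) || sbefore s m m']].

Definition isvertex (s : vertex) : bool := (s != set0) && (s \subset gens).

Definition edge (s s' : vertex) : bool :=
  [&& isvertex s, isvertex s', s' \subset s & #|s| == #|s'|.+1].

Definition matched (t s : vertex) : bool :=
  [&& isvertex s, (0 < uval s)%N, nmin s \notin s & t == nmin s |: s].

Definition medge (s t : vertex) : bool :=
  (edge s t && ~~ matched s t) || matched t s.

Definition critical (s : vertex) : bool :=
  isvertex s && [forall t, ~~ matched s t && ~~ matched t s].

(* s' = s \ {m_r}: the product has the single index m = m_r. *)
Definition incidence (s s' : vertex) : St :=
  \prod_(m in s :\: s') (-1) ^+ #|[set m' in s | (m' == m) || before m' m]|.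

(* m(P) for the path P through s followed by the vertices of p. *)
Fixpoint path_weight (s : vertex) (p : seq vertex) : St :=
  if p is t :: p' then
    (if matched t s then - incidence t s else incidence s t) * path_weight t p'
  else 1.

(* A gradient path repeats no vertex, the matching being acyclic, so bounding
   the number of its steps by the number of vertices excludes no path. *)
Definition gradient_sum (s t : vertex) : St :=
  \sum_(p : #|{: vertex}|.-bseq vertex | path medge s p && (last s p == t))
     path_weight s p.

(* The set {(i_1,j_1), ..., (i_q,j_q)} attached to a critical s; the m_<i> with
   i < nu m are pairwise distinct, so the i_r are the i with m_<i> in s. *)
Definition Fcrit (s : vertex) : {set 'I_n * 'I_d} :=
  [set p : 'I_n * 'I_d | [&& (p.1.+1 < nu (top s))%N, bracket (top s) p.1 \in s
             & p.2 == partial_deg (top s) p.1 :> nat]].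

Definition Qidx q : pred vertex := fun s => critical s && (#|s| == q.+1).

Definition Qmod (q : nat) : lmodType St := {ffun {s | Qidx q s} -> St^o}.

Definition Qdiff_val q (s : vertex) : Qmod q :=
  \sum_(p in Fcrit s) ((-1) ^+ frank (Fcrit s) p * 'X_[pvar p])
      *: basisv (s :\ bracket (top s) p.1)
  - (-1) ^+ q.+1 *:
    \sum_(t : vertex | Qidx q t)
      (gradient_sum (s :\ top s) t * 'X_[lcmset s - lcmset t]) *: basisv t.

Definition Qdiff (q : nat) : {linear Qmod q.+1 -> Qmod q} :=
  linext (fun s : {s | Qidx q.+1 s} => Qdiff_val q (val s)).

Definition QtoP (q : nat) : {linear Qmod q -> Pmod q.+1} :=
  linext (fun s : {s | Qidx q s} =>
    basisv (Fcrit (val s), top (val s)) : Pmod q.+1).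
End Resolutions.

(* Main.v *)
(* Both differentials agree on the summand x_{i_r,j_r} e(F_r, m), so the point is
   to find the gradient paths that leave sigma \ {m_sigma}.  They are not listed.
   - Rigidity: lcm and the top element do not increase along a gradient path, and
     an admissible pair (F', m') with #F' = #F - 1, m' <> m, whose variables occur
     among those of (F, m), is (F_r, m_<i_r>) for some r.  So only the expected
     critical sets are reached.
   - The remaining coefficients follow by induction on #F from the fact that the
     Morse differential squares to zero: the component of d^2 e(F, m) at
     (F \ {p, q}, m_<p>) has two terms only, which expresses the coefficient of
     (F, m) through the one of (F \ {q}, m); for #F = 1 the path is trivial.
   That Q is a complex is Morse theory again, and P inherits it.
   A monomial m is handled through its nondecreasing word alpha_1 ... alpha_e:
   variables of b-pol(m) are pairs (letter, column), and m_<i> is the unique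
   generator whose word is a prefix of the word of m with column j_i set to i. *)

Require Import Defs.
From mathcomp Require Import all_boot all_order all_algebra.
From mathcomp Require Import mpoly zify.

Set Implicit Arguments.
Unset Strict Implicit.
Unset Printing Implicit Defensive.

Import GRing.Theory.
Local Open Scope ring_scope.

(** * Discrete Morse theory *)

(** The differential of Q treats the face without the top apart, yet it is the full Morse
    differential: a face of a critical set that keeps the top is critical again, so only the empty
    path leads from it to a critical set of the same size, and the sign before the path sum is the
    incidence sign of the top, which comes last. This lets the general theory compute its square.
    The coefficients [cdiff] are kept free of monomials; since a nonzero one forces the lcm to
    shrink, the quotients of lcms can be restored at the end and multiply. The obstacle is the
    matching itself: u(s) is a position in a list sorted by an order that depends on s. It is
    replaced by the set [Dset s] of generators that divide the lcm of the elements of s after them;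
    n_s is its least element, matched edges toggle n_s, and critical means that [Dset s] is empty.
    Acyclicity is proved by an explicit rank that decreases along every step, which also makes the
    bounded path sums satisfy their recursion. *)

Section AlgebraicMorse.
Context {R : comNzRingType} {T : finType} (e mt : rel T) (inc : T -> T -> R).

Definition mstep s t := (e s t && ~~ mt s t) || mt t s.
Definition mweight s t : R := if mt t s then - inc t s else inc s t.
Definition mcrit s := [forall t, ~~ mt s t && ~~ mt t s].

Fixpoint mpath_weight s (p : seq T) : R :=
  if p is t :: p' then mweight s t * mpath_weight t p' else 1.

Definition msum N s t : R :=
  \sum_(p : N.-bseq T | path mstep s p && (last s p == t)) mpath_weight s p.

Lemma msum0 s t : msum 0 s t = (s == t)%:R.
Proof.
rewrite /msum (eq_bigr (fun=> 1)); last by move=> [[|? ?] //=].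
rewrite (eq_bigl (fun p => (p == [bseq]) && (s == t))); last first.
  by move=> [[|? ?] //= ?]; rewrite eqE.
case: (s == t); last by rewrite big_pred0 // => p; rewrite andbF.
by rewrite (big_pred1 [bseq]) // => p; rewrite andbT.
Qed.

Lemma msumS N s t :
  msum N.+1 s t = (s == t)%:R + \sum_(u | mstep s u) mweight s u * msum N u t.
Proof.
(* The paths are sorted by their first vertex after s; [None] stands for the empty path. *)
rewrite /msum (partition_big (fun p : N.+1.-bseq T => ohead p) xpredT) //=.
rewrite (bigD1 None) //=; congr (_ + _).
  rewrite (eq_bigr (fun=> 1)); last by move=> [[|? ?] //= ? /andP[]].
  rewrite (eq_bigl (fun p => (p == [bseq]) && (s == t))); last first.
    by move=> [[|? ?] //= ?]; rewrite eqE /= ?andbT ?andbF.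
  case: (s == t); last by rewrite big_pred0 // => p; rewrite andbF.
  by rewrite (big_pred1 [bseq]) // => p; rewrite andbT.
rewrite (reindex_omap Some id) /=; last by case.
rewrite [in RHS]big_mkcond; apply: eq_big => [x|x _]; first by rewrite eqxx.
case: ifP => sx; last first.
  rewrite big_pred0 // => -[[|y p] //= ?]; first by rewrite andbF.
  by apply/negP => /andP[/andP[/andP[sy _] _] /eqP[yx]]; rewrite -yx sy in sx.
rewrite big_distrr /=.
have sz (p : N.-bseq T) : (size (x :: p) <= N.+1)%N by rewrite ltnS size_bseq.
have szb (p : N.+1.-bseq T) : (size (behead p) <= N)%N.
  by case: p => [[|? ?] ?].
rewrite (reindex_onto (fun p : N.-bseq T => Bseq (sz p)) (fun p => Bseq (szb p))) /=.
  apply: eq_big => [p|p _]; last by [].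
  have -> : (Bseq (szb (Bseq (sz p))) == p) = true by apply/eqP/val_inj.
  by rewrite sx /= eqxx !andbT.
move=> [[|y p] szp] /andP[_ /eqP] //= [xy].
by apply: val_inj; rewrite /= xy.
Qed.

Context (rk : T -> nat).
Context (rk_step : forall s t, mstep s t -> (rk t < rk s)%N).

(** Ranks strictly decrease, so the vertices after s on a path are distinct and of smaller rank;
    their number bounds the length. *)
Lemma msum_stable N s t : (#|[set x | (rk x < rk s)%N]| <= N)%N ->
  msum N.+1 s t = msum N s t.
Proof.
elim: N s => [|N IH] s hs.
  rewrite msumS msum0 big_pred0 ?addr0 // => u; apply/negP => /rk_step us.
  by move: hs; rewrite leqn0 cards_eq0 => /eqP/setP/(_ u); rewrite !inE us.
rewrite msumS [RHS]msumS; congr (_ + _); apply: eq_bigr => u su.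
congr (_ * _); apply: IH; rewrite -ltnS; apply: leq_trans hs.
apply: proper_card; apply/properP; split.
  by apply/subsetP => x; rewrite !inE => /ltn_trans; apply; apply: rk_step.
by exists u; rewrite !inE ?ltnn //; apply: rk_step.
Qed.

(* As [rk] decreases along steps, the bound #|T| excludes no path. *)
Definition mflow s t : R := msum #|T| s t.

Lemma mflowE s t :
  mflow s t = (s == t)%:R + \sum_(u | mstep s u) mweight s u * mflow u t.
Proof. by rewrite -msumS msum_stable // max_card. Qed.

(** A nonzero flow needs some path, so any reflexive relation propagated by steps holds between its
    ends. Used contrapositively, this makes coefficients vanish. *)
Lemma mflow_connect (P : T -> T -> Prop) s t :
  (forall x, P x x) -> (forall x y z, mstep x y -> P y z -> P x z) ->
  mflow s t != 0 -> P s t.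
Proof.
move=> P0 PS; rewrite /mflow /msum.
case: (pickP (fun p : #|T|.-bseq T => path mstep s p && (last s p == t))) => [p|no].
  case/andP=> + /eqP<- _; elim: (val p) s => //= y q IH s /andP[sy /IH].
  exact: PS.
by rewrite big_pred0 // eqxx.
Qed.

Context (dim : T -> nat).
Context (dim_edge : forall s t, e s t -> dim s = (dim t).+1).
Context (mt_edge : forall s t, mt s t -> e s t).
Context (mt_funl : forall t t' s, mt t s -> mt t' s -> t = t').
Context (mt_funr : forall t s s', mt t s -> mt t s' -> s = s').
Context (mt_alt : forall t s r, mt t s -> mt s r = false).
Context (inc_sq : forall t s, mt t s -> inc t s * inc t s = 1).
Context (inc_inc : forall s r,
  \sum_(t | e s t && e t r) inc s t * inc t r = 0).

Lemma mstep_dn s t : e s t -> ~~ mt s t -> mstep s t.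
Proof. by rewrite /mstep => -> ->. Qed.

Lemma mweight_dn s t : e s t -> mweight s t = inc s t.
Proof.
rewrite /mweight => st; case: ifP => // /mt_edge/dim_edge; move/dim_edge: st; lia.
Qed.

Lemma mweight_up s t : mt t s -> mweight s t = - inc t s.
Proof. by rewrite /mweight => ->. Qed.

(* A path that has reached the lower end of its matched edge, or a smaller
   dimension, cannot end in a critical vertex of dimension [dim t]. *)
Lemma mflow_low s t : mcrit t ->
  (dim s < dim t)%N \/ dim s = dim t /\ (exists r, mt s r) -> mflow s t = 0.
Proof.
move=> ct; have [N] := ubnP (rk s); elim: N s => // N IH s /ltnSE rs low.
rewrite mflowE big1 ?addr0 => [|u su].
  case: eqP => // st; subst t; case: low => [|[_ [r sr]]]; first by rewrite ltnn.
  by move/forallP/(_ r): ct; rewrite sr.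
rewrite IH ?mulr0 //; first exact: leq_trans (rk_step su) rs.
(* A vertex that is the larger end of a matched edge admits no upward step ([mt_alt]). An upward
   step from below [dim t] stays below it or lands in it, at the larger end of the edge just
   used. *)
case/orP: su => [/andP[/dim_edge du _]|us]; first by left; case: low => [|[]]; lia.
move/mt_edge/dim_edge: (us) => du.
case: low => [|[_ [r sr]]]; last by move: sr; rewrite (mt_alt _ us).
rewrite leq_eqVlt => /orP[/eqP|]; last by left; rewrite du.
by right; split; [rewrite du|exists s].
Qed.

(** Every step leaving a critical vertex goes down, and [mflow_low] forbids reaching t from there:
    climbing back ends at the larger end of a matched edge. *)
Lemma mflow_crit s t : mcrit s -> mcrit t -> dim s = dim t ->
  mflow s t = (s == t)%:R.
Proof.
move=> cs ct dst; rewrite mflowE big1 ?addr0 // => u.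
case/orP=> [/andP[/dim_edge du _]|us]; last first.
  by move/forallP/(_ u): cs; rewrite us andbF.
by rewrite mflow_low ?mulr0 //; left; rewrite -dst du.
Qed.

(** Cancellation of a matched pair: a path from s to t has to climb to b and goes on through the
    other faces of b, so the term of s is minus the sum of the other terms. *)
Lemma mflow_boundary b t s : mcrit t -> dim s = dim t -> mt b s ->
  \sum_(u | e b u) inc b u * mflow u t = 0.
Proof.
move=> ct ds bs; rewrite (bigD1 s) /=; last exact: mt_edge.
have E : mflow s t = - inc b s * mflow b t.
  rewrite mflowE (_ : (s == t) = false) ?add0r; last first.
    by apply/eqP => st; subst t; move/forallP/(_ b): ct; rewrite bs andbF.
  rewrite (bigD1 b) /=; last by rewrite /mstep bs orbT.
  rewrite mweight_up // big1 ?addr0 // => u /andP[/orP[/andP[/dim_edge du _]|us] ub].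
    by rewrite mflow_low ?mulr0 //; left; rewrite -ds du.
  by rewrite (mt_funl us bs) eqxx in ub.
suff : mflow b t = \sum_(u | e b u && (u != s)) inc b u * mflow u t.
  by move=> <-; rewrite E mulrA mulrN inc_sq // mulN1r addNr.
rewrite mflowE (_ : (b == t) = false) ?add0r; last first.
  by apply/eqP => bt; subst t; move/mt_edge/dim_edge: bs; lia.
apply: eq_big => [u|u].
  rewrite /mstep; case: (boolP (mt u b)) => [/(mt_alt s)|_].
    by rewrite bs.
  rewrite orbF; case: (boolP (e b u)) => //= bu.
  by congr (~~ _); apply/idP/eqP => [/mt_funr/(_ bs)|->].
case/orP=> [/andP[bu _]|/(mt_alt s)]; first by rewrite mweight_dn.
by rewrite bs.
Qed.

(** The Morse differential when s and t are critical; the induction below needs it at noncritical s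
    as well. *)
Definition mdiff s t : R := \sum_(u | e s u) inc s u * mflow u t.

(** The flow to critical vertices is a chain map. If s is the larger end of a matched edge, both
    sides vanish; if s is critical, its flow is trivial; if s is the smaller end, the identity is
    carried over from the other faces of b. *)
Lemma mdiff_flow s t q : dim s = q.+1 -> dim t = q -> mcrit t ->
  mdiff s t = \sum_(u | mcrit u && (dim u == q.+1)) mflow s u * mdiff u t.
Proof.
move=> + dt ct; have [N] := ubnP (rk s); elim: N s => // N IH s /ltnSE rs ds.
have [/existsP[b bs]|nup] := boolP [exists b, mt b s]; last first.
  have [/existsP[r sr]|ndn] := boolP [exists r, mt s r].
    rewrite big1 => [|u /andP[cu /eqP du]]; last first.
      by rewrite mflow_low ?mul0r //; right; split; [rewrite ds|exists r].
    apply: (mflow_boundary (s := r)) => //.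
    by move/mt_edge/dim_edge: sr; lia.
  have cs : mcrit s.
    apply/forallP => x; move: nup ndn.
    by rewrite !negb_exists => /forallP/(_ x)-> /forallP/(_ x)->.
  rewrite (bigD1 s) /=; last by rewrite cs ds eqxx.
  rewrite mflow_crit // eqxx mul1r big1 ?addr0 // => u /andP[/andP[cu /eqP du] us].
  by rewrite mflow_crit // ?ds // eq_sym (negbTE us) mul0r.
have es := mt_edge bs.
(* [F u] is the defect of the identity at [u]; its sum over the faces of [b]
   vanishes because both terms kill the boundary of [b]. *)
pose F u := mdiff u t - \sum_(v | mcrit v && (dim v == q.+1)) mflow u v * mdiff v t.
have sumF : \sum_(u | e b u) inc b u * F u = 0.
  rewrite /F; under eq_bigr => u _ do rewrite mulrBr.
  rewrite sumrB; set A := \sum_(u | _) _; set B := \sum_(u | _) _.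
  have -> : A = 0.
    rewrite /A /mdiff; under eq_bigr => u _ do rewrite big_distrr /=.
    rewrite (exchange_big_dep xpredT) //= big1 // => r _.
    rewrite -[RHS](mul0r (mflow r t)) -[X in _ = X * _](inc_inc b r) mulr_suml.
    by apply: eq_bigr => u _; rewrite mulrA.
  have -> : B = 0; last by rewrite subrr.
  rewrite /B; under eq_bigr => u _ do rewrite big_distrr /=.
  rewrite exchange_big /= big1 // => v /andP[cv /eqP dv].
  rewrite -[RHS](mul0r (mdiff v t)) -[X in _ = X * _](mflow_boundary (b := b) (s := s) cv) ?ds ?dv //.
  by rewrite mulr_suml; apply: eq_bigr => u _; rewrite mulrA.
(* From s one steps up to b and then down to u, so u has smaller rank than s. *)
have F0 u : e b u -> u != s -> F u = 0.
  move=> bu us; apply/eqP; rewrite subr_eq0; apply/eqP; apply: IH.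
    have bu' : mstep b u.
      by apply: mstep_dn => //; apply: contra us => /mt_funr/(_ bs)->.
    apply: leq_trans (rk_step bu') _; apply: leq_trans rs.
    by rewrite ltnW // rk_step // /mstep bs orbT.
  by move/dim_edge: bu; move/dim_edge: es; lia.
apply/eqP; rewrite -subr_eq0 -/(F s); move: sumF.
rewrite (bigD1 s) //= big1 ?addr0 => [/(congr1 ( *%R (inc b s)))|u /andP[bu us]].
  by rewrite mulrA inc_sq // mul1r mulr0 => ->.
by rewrite F0 ?mulr0.
Qed.

(** By [mdiff_flow] the sum becomes the flow of a double boundary. *)
Theorem mdiff_mdiff s t q : dim s = q.+2 -> dim t = q -> mcrit t ->
  \sum_(u | mcrit u && (dim u == q.+1)) mdiff s u * mdiff u t = 0.
Proof.
move=> ds dt ct.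
transitivity (\sum_(v | e s v) inc s v * mdiff v t).
  rewrite [X in _ = X](eq_bigr (fun v => \sum_(u | mcrit u && (dim u == q.+1))
      inc s v * mflow v u * mdiff u t)); last first.
    move=> v sv; rewrite (@mdiff_flow _ _ q) //; last by move/dim_edge: sv; lia.
    by rewrite big_distrr; apply: eq_bigr => u _; rewrite -mulrA.
  by rewrite exchange_big /=; apply: eq_bigr => u _; rewrite mulr_suml.
rewrite /mdiff; under eq_bigr => u _ do rewrite big_distrr /=.
rewrite (exchange_big_dep xpredT) //= big1 // => r _.
rewrite -[RHS](mul0r (mflow r t)) -[X in _ = X * _](inc_inc s r) mulr_suml.
by apply: eq_bigr => u _; rewrite mulrA.
Qed.

End AlgebraicMorse.

(** * Monomials as words *)

Section Words.
Context {n : nat}.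
Implicit Types (m : 'X_{1..n}) (w : seq 'I_n) (i : 'I_n) (j : nat).
Local Open Scope nat_scope.

Let ole (a b : 'I_n) := a <= b.
Let ole_trans : transitive ole. Proof. by move=> y x z; apply: leq_trans. Qed.

Lemma count_factors m i : count_mem i (factors m) = m i.
Proof.
rewrite /factors count_flatten sumnE -map_comp big_map big_enum /=.
rewrite (bigD1 i) //= count_nseq /= eqxx mul1n big1 ?addn0 // => l li.
by rewrite count_nseq /= (negbTE li).
Qed.

Lemma mem_factors m i : (i \in factors m) = (0 < m i).
Proof. by rewrite -count_factors -has_count has_pred1. Qed.

Lemma sorted_factors m : sorted ole (factors m).
Proof.
rewrite sorted_pairwise // /factors.
have: pairwise (fun a b : 'I_n => a < b) (enum 'I_n).
  rewrite -(pairwise_map val ltn) val_enum_ord -sorted_pairwise ?iota_ltn_sorted //.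
  exact: ltn_trans.
elim: (enum 'I_n) => //= a s IH /andP[/allP as_ /IH ps].
rewrite pairwise_cat ps andbT; apply/andP; split.
  apply/allrelP => x y /nseqP[-> _] /flattenP[t /mapP[b bs ->] /nseqP[-> _]].
  exact: ltnW (as_ _ bs).
elim: (m a) => //= N ->; rewrite andbT.
by apply/allP => y /nseqP[-> _]; rewrite /ole.
Qed.

Lemma factors_eq m w : sorted ole w -> (forall i, count_mem i w = m i) ->
  factors m = w.
Proof.
move=> sw cw; apply: (sorted_eq ole_trans _ (sorted_factors m) sw).
  by move=> a b /anti_leq/val_inj.
by apply/allP => i _ /=; rewrite cw count_factors.
Qed.

Lemma size_factors m : size (factors m) = mdeg m.
Proof.
rewrite -sum1_size mdegE (partition_big id xpredT) //=.
by apply: eq_bigr => i _; rewrite sum1_count count_factors.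
Qed.

(* The default value n makes [col m] nondecreasing on all of nat, and makes a
   word smaller than its proper prefixes for the lexicographic order. *)
Definition col m j : nat := nth n (map val (factors m)) j.

Lemma colE m j i : j < mdeg m -> col m j = nth i (factors m) j.
Proof. by move=> jm; rewrite /col (nth_map i) // size_factors. Qed.

Lemma col_ltn m j : (col m j < n) = (j < mdeg m).
Proof.
case: (ltnP j (mdeg m)) => jm; last by rewrite /col nth_default ?ltnn ?size_map ?size_factors.
have /mapP[i _ ci] : col m j \in map val (factors m) by rewrite mem_nth ?size_map ?size_factors.
by rewrite ci ltn_ord.
Qed.

Lemma col_default m j : mdeg m <= j -> col m j = n.
Proof. by move=> jm; rewrite /col nth_default // size_map size_factors. Qed.

Lemma onth_factors m j i : (onth (factors m) j == Some i) = (col m j == i :> nat).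
Proof.
case: (ltnP j (mdeg m)) => jm; last first.
  rewrite onth_default ?size_factors // col_default //; apply/esym.
  by apply/negbTE; rewrite neq_ltn ltn_ord orbT.
rewrite (colE i) // onthE (nth_map i) ?size_factors //.
Qed.

Lemma col_mono m : {homo col m : a b / a <= b}.
Proof.
move=> a b ab; case: (ltnP b (mdeg m)) => bm; last first.
  rewrite (col_default bm); case: (ltnP a (mdeg m)) => am; first by rewrite ltnW ?col_ltn.
  by rewrite col_default.
have i : 'I_n by apply: (Ordinal (m := col m b)); rewrite col_ltn.
rewrite !(colE i) //; last exact: leq_ltn_trans bm.
have ole_refl : reflexive ole by move=> x; apply: leqnn.
apply: (sorted_leq_nth ole_trans ole_refl i (sorted_factors m)) => //; rewrite inE size_factors //.
exact: leq_ltn_trans bm.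
Qed.

Lemma partial_degE m i : partial_deg m i = count (fun a : 'I_n => a <= i) (factors m).
Proof.
rewrite /partial_deg -[RHS]sum1_count [RHS](partition_big id (fun l : 'I_n => l <= i)) //=.
apply: eq_bigr => l li; rewrite -count_factors -sum1_count.
by apply: eq_bigl => x /=; case: eqP => [->|]; rewrite ?li ?andbF.
Qed.

(** A Galois connection between columns and letters, through which statements on exponents become
    comparisons of columns. Columns past the end hold n, which exceeds every letter. *)
Lemma partial_deg_col m i j : (j < partial_deg m i) = (col m j <= i).
Proof.
rewrite partial_degE /col; move: (sorted_factors m); rewrite sorted_pairwise //.
elim: (factors m) j => [|x w IH] j /=; first by rewrite nth_nil [in RHS]leqNgt ltn_ord.
case/andP=> /allP xw /IH {}IH; case: (leqP x i) => xi.
  by case: j => [|j] /=; rewrite ?xi ?add1n ?ltnS ?IH.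
have /eqP -> : count (fun a : 'I_n => a <= i) w == 0.
  rewrite eqn0Ngt -has_count; apply/hasPn => y /xw; rewrite /ole -ltnNge.
  exact: leq_trans.
case: j => [|j] /=; first by rewrite (leqNgt x i) xi.
rewrite ltn0; apply/esym/negbTE; rewrite -ltnNge.
case: (ltnP j (size w)) => jw; last by rewrite nth_default ?size_map.
have /mapP[y yw ->] : nth n (map val w) j \in map val w by rewrite mem_nth ?size_map.
exact: leq_trans xi (xw _ yw).
Qed.

(** [partial_deg m i] is the column of the first letter beyond i, so the word reaches it exactly
    when such a letter exists. It is also the column that [borel_step] changes. *)
Lemma nu_col m i : (i.+1 < nu m) = (partial_deg m i < mdeg m).
Proof.
rewrite -col_ltn; apply/idP/idP.
  apply: contraLR; rewrite -!leqNgt => ni; apply/bigmax_leqP => l ml.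
  move: ml; rewrite -mem_factors => /(nthP l)[j]; rewrite size_factors => jm jl.
  rewrite ltnS -jl -colE // -partial_deg_col ltnNge; apply/negP => /(col_mono m).
  by apply/negP; rewrite -ltnNge; apply: leq_trans ni; rewrite col_ltn.
move=> cn; pose l := Ordinal cn.
have il : i < l by rewrite ltnNge /= -partial_deg_col ltnn.
have ml : 0 < m l.
  rewrite -mem_factors; apply/onthP; exists (partial_deg m i); apply/eqP.
  by rewrite onth_factors.
exact: leq_trans (leq_bigmax_cond _ ml).
Qed.

Lemma prefix_colP m1 m :
  reflect (forall j, j < mdeg m1 -> col m1 j = col m j) (prefix (factors m1) (factors m)).
Proof.
apply: (iffP idP) => [|mm].
  by case/prefixP => w E j jm; rewrite /col E map_cat nth_cat size_map size_factors jm.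
have sz : mdeg m1 <= mdeg m.
  case H : (mdeg m1) => [//|N]; rewrite -col_ltn -mm ?H // col_ltn H //.
rewrite prefixE size_factors; apply/eqP/esym/eq_from_onth_le => j.
rewrite !size_takel ?size_factors // maxnn => jm.
have i := Ordinal (etrans (col_ltn m1 j) jm).
rewrite !onthE !(nth_map i) ?size_takel ?size_factors // nth_take //.
by have:= mm _ jm; rewrite !(colE i) // ?(leq_trans jm) // => /val_inj ->.
Qed.

Lemma prefix_lem m1 m : prefix (factors m1) (factors m) -> (m1 <= m)%MM.
Proof.
case/prefixP => w E; apply/mnm_lepP => i.
by rewrite -!count_factors E count_cat leq_addr.
Qed.

Lemma lem_deg m1 m : (m1 <= m)%MM -> mdeg m1 <= mdeg m.
Proof. by move/mnm_lepP => le; rewrite !mdegE; apply: leq_sum. Qed.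

Lemma mu_leq m i : 0 < m i -> mu m <= i.+1.
Proof.
rewrite /mu => mi; have: i \in index_enum 'I_n by rewrite mem_index_enum.
elim: (index_enum _) => //= a s IH; rewrite inE big_cons => /orP[/eqP<-|/IH le].
  by rewrite mi geq_minl.
by case: ifP => _ //; rewrite geq_min le orbT.
Qed.

(** The inequality says that the words of m1 and of m/m1 concatenate to a nondecreasing word, which
    can only be the word of m. *)
Lemma gpart_cond m1 m :
  (m1 <= m)%MM && (nu m1 <= mu (m - m1)%MM) = prefix (factors m1) (factors m).
Proof.
apply/andP/idP => [[/mnm_lepP le numu]|pf].
  apply/prefixP; exists (factors (m - m1)%MM); apply: factors_eq => [|i]; last first.
    by rewrite count_cat !count_factors mnmBE subnKC.
  rewrite sorted_pairwise // pairwise_cat -!sorted_pairwise // !sorted_factors !andbT.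
  apply/allrelP => x y; rewrite !mem_factors => xm ym; rewrite /ole -ltnS.
  apply: (@leq_trans (nu m1)); first exact: (leq_bigmax_cond _ xm).
  apply: leq_trans numu _.
  exact: mu_leq.
split; first exact: prefix_lem.
case/prefixP: pf => w E.
have cw i : count_mem i w = (m - m1)%MM i.
  by rewrite mnmBE -!count_factors E count_cat addKn.
apply/bigmax_leqP => x; rewrite -mem_factors => xm.
have := sorted_factors m; rewrite sorted_pairwise // E pairwise_cat => /andP[/allrelP le _].
rewrite /mu; elim/big_ind: _ => [|a b ha hb|y ym].
- exact: leqW (ltn_ord x).
- by rewrite leq_min ha hb.
- by rewrite ltnS; apply: le => //; rewrite -has_pred1 has_count cw.
Qed.

Lemma mdeg_sub1_lt m i : 0 < m i -> mdeg (m - U_(i))%MM < mdeg m.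
Proof.
move=> mi; have im : (U_(i) <= m)%MM by apply/mnm_lepP => l; rewrite mnm1E; case: eqP => [<-|].
by rewrite -[in X in _ < X](submK im) mdegD mdeg1 addn1.
Qed.

Lemma factors_belast m i : 0 < m i -> (forall l, 0 < m l -> l <= i) ->
  prefix (factors (m - U_(i))%MM) (factors m).
Proof.
move=> mi maxi; apply/prefixP; exists [:: i].
have im : (U_(i) <= m)%MM by apply/mnm_lepP => l; rewrite mnm1E; case: eqP => [<-|].
apply: factors_eq => [|l].
  rewrite sorted_pairwise // pairwise_cat -!sorted_pairwise // sorted_factors !andbT.
  apply/allrelP => x y; rewrite mem_factors inE mnmBE => xm /eqP->; apply: maxi.
  exact: leq_trans xm (leq_subr _ _).
by rewrite count_cat count_factors /= addn0 mnmBE mnm1E subnK //; case: eqP => [<-|].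
Qed.

Lemma borel_stepE m i : i.+1 < nu m -> exists k : 'I_n,
  [/\ k = col m (partial_deg m i) :> nat, 0 < m k, i < k
    & borel_step m i = (m - U_(k) + U_(i))%MM].
Proof.
rewrite nu_col => ipd; set p := partial_deg m i in ipd *.
have cp : col m p < n by rewrite col_ltn.
pose k := Ordinal cp.
have ik : i < k by rewrite ltnNge /= -partial_deg_col ltnn.
have mk : 0 < m k by rewrite -mem_factors; apply/onthP; exists p; apply/eqP; rewrite onth_factors.
have argk : [arg min_(l < i | (i < l) && (0 < m l)) (l : nat)] = k.
  rewrite /arg_min /extremum; case: pickP => [l /andP[/andP[il ml] /forallP lmin]|/(_ k) /negbT].
    apply/val_inj/anti_leq/andP; split.
      by move/(_ k)/implyP: lmin; apply; rewrite ik mk.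
    move: ml; rewrite -mem_factors => /(nthP k)[j']; rewrite size_factors => jm jl.
    move: il; rewrite /= -jl -!colE // ltnNge -partial_deg_col -leqNgt; exact: col_mono.
  case/nandP=> [|/forallPn[l]]; first by rewrite ik mk.
  rewrite negb_imply -ltnNge => /andP[/andP[il]].
  rewrite -mem_factors => /(nthP k)[j']; rewrite size_factors => jm jl.
  move: il; rewrite -jl -!colE // ltnNge -partial_deg_col -leqNgt.
  by move/(col_mono m) => le lt; have := leq_ltn_trans le lt; rewrite ltnn.
by exists k; split; rewrite // /borel_step argk.
Qed.

(** Overwriting this column with i keeps the word sorted: earlier letters are at most i, later ones
    at least the replaced letter k > i. *)
Lemma borel_step_col m i j : i.+1 < nu m ->
  col (borel_step m i) j = if j == partial_deg m i then i : nat else col m j.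
Proof.
move=> im; have [k [kE mk ik bE]] := borel_stepE im; move: im.
rewrite nu_col; set p := partial_deg m i in kE * => ipd.
have F : factors m = take p (factors m) ++ k :: drop p.+1 (factors m).
  rewrite -{1}(cat_take_drop p (factors m)); congr (_ ++ _).
  rewrite (drop_nth k) ?size_factors //; congr (_ :: _); apply: val_inj.
  by rewrite /= -colE // -kE.
have FB : factors (borel_step m i) = take p (factors m) ++ i :: drop p.+1 (factors m).
  apply: factors_eq => [|l]; last first.
    rewrite bE mnmDE mnmBE !mnm1E -(count_factors m l) [in RHS]F.
    by rewrite !count_cat /= addnCA [in RHS]addnCA addKn addnC.
  move: (sorted_factors m); rewrite {1}F !sorted_pairwise // !pairwise_cat /=.
  case/and3P=> al -> /andP[kd ->]; rewrite !andbT /=.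
  move: al; rewrite !allrel_consr => /andP[_ ->]; rewrite andbT.
  apply/andP; split; last first.
    apply: sub_all kd => x; apply: leq_trans; exact: ltnW.
  apply/allP => x /(nthP i)[j']; rewrite size_take size_factors ipd => jp <-.
  rewrite nth_take // /ole -colE ?(ltn_trans jp) // -partial_deg_col //.
rewrite /col FB [in RHS]F !map_cat !nth_cat size_map size_takel ?size_factors ?(ltnW ipd) //=.
have [jp|jp|->] := ltngtP j p => //; last by rewrite subnn.
by case: (j - p) (subn_gt0 p j) => [|N]; rewrite ?jp.
Qed.

Lemma mdeg_borel_step m i : i.+1 < nu m -> mdeg (borel_step m i) = mdeg m.
Proof.
move=> im; have E j : (j < mdeg (borel_step m i)) = (j < mdeg m).
  rewrite -!col_ltn borel_step_col //; case: eqP => // ->.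
  by rewrite ltn_ord col_ltn -nu_col.
by apply/anti_leq/andP; split; rewrite leqNgt; [rewrite E ltnn | rewrite -E ltnn].
Qed.
End Words.

(** * Generators of Borel fixed ideals *)

Section BorelIdeal.
Context {k : fieldType} {n : nat} (I : {pred {mpoly k[n]}}) (hI : borel_fixed I).
Implicit Types m : 'X_{1..n}.

Lemma memI_lem m m' : (m <= m')%MM -> 'X_[m] \in I -> 'X_[m'] \in I.
Proof.
move=> mm'; case: hI => -[M HM] _ /HM[s Ms E]; apply/HM.
exists [seq ('X_[m' - m] * a.1, a.2) | a <- s] => [a /mapP[b bs ->] /=|]; first exact: (Ms b).
rewrite -(submK mm') mpolyXD E big_map big_distrr /=.
by apply: eq_bigr => a _; rewrite mulrA addmK.
Qed.

Lemma mingen_min m m' : mingen I m -> 'X_[m'] \in I -> (m' <= m)%MM -> m' = m.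
Proof.
case/andP=> _ /forallP H Im' le.
have dm : (mdeg m' < (mdeg m).+1)%N by rewrite ltnS lem_deg.
by apply/eqP; move/implyP: (H (BMultinom dm)) => /=; rewrite le Im'; apply.
Qed.

Lemma not_mingen m : 'X_[m] \in I -> ~~ mingen I m ->
  exists2 i, (0 < m i)%N & 'X_[m - U_(i)] \in I.
Proof.
move=> Im; rewrite /mingen Im /= => /forallPn[m']; rewrite negb_imply.
case/andP=> /andP[le Im'] ne.
have [i lti] : exists i : 'I_n, (m' i < m i)%N.
  apply/existsP; apply: contraR ne => /existsPn nlt; apply/eqP/mnmP => i.
  by apply/anti_leq; rewrite (mnm_lepP le) leqNgt nlt.
exists i; first exact: (leq_ltn_trans (leq0n _) lti).
apply: memI_lem Im'; apply/mnm_lepP => l; rewrite mnmBE mnm1E.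
by case: eqP => [<-|_]; [rewrite subn1 -ltnS prednK ?(leq_ltn_trans _ lti) | rewrite subn0 (mnm_lepP le)].
Qed.

Lemma ex_mingen m : 'X_[m] \in I -> exists2 g, mingen I g & (g <= m)%MM.
Proof.
have [N] := ubnP (mdeg m); elim: N m => // N IH m dm Im.
have [gm|ng] := boolP (mingen I m); first by exists m; rewrite ?lepm_refl.
have [i mi Ii] := not_mingen Im ng.
have [||g gg le] := IH (m - U_(i))%MM => //.
  exact: leq_trans (mdeg_sub1_lt mi) dm.
exists g => //; apply: lepm_trans le _.
by apply/mnm_lepP => l; rewrite mnmBE leq_subr.
Qed.

(** Extends the exchange property from generators to I. A generator g below m either does not
    contain x_i, and then divides the new monomial, or admits the exchange itself. *)
Lemma borel_memI m (i j : 'I_n) : 'X_[m] \in I -> (0 < m i)%N -> (j < i)%N ->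
  'X_[m - U_(i) + U_(j)] \in I.
Proof.
move=> /ex_mingen[g gg /mnm_lepP le] mi ji.
have [gi|] := posnP (g i).
  apply: memI_lem (_ : 'X_[g] \in I); last by case/andP: gg.
  apply/mnm_lepP => l; rewrite mnmDE mnmBE !mnm1E; have := le l.
  by case: (i =P l) => [<-|_]; [rewrite gi | rewrite subn0 => ?; apply: leq_trans (leq_addr _ _)].
move=> gi; apply: memI_lem (hI.2 _ _ _ gg gi ji); apply/mnm_lepP => l.
by rewrite !mnmDE !mnmBE leq_add2r leq_sub2r.
Qed.

(* Deleting the last letter of a word stays in I as soon as deleting some
   letter does; hence the generator can be reached by truncation. *)
Lemma prefix_mingen m : 'X_[m] \in I ->
  exists2 g, mingen I g & prefix (factors g) (factors m).
Proof.
have [N] := ubnP (mdeg m); elim: N m => // N IH m dm Im.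
have [gm|ng] := boolP (mingen I m); first by exists m; rewrite ?prefix_refl.
have [i mi Ii] := not_mingen Im ng.
pose l := [arg max_(l > i | (0 < m l)%N) (l : nat)].
have [ml lmax] : (0 < m l)%N /\ forall a, (0 < m a)%N -> (a <= l)%N.
  by rewrite /l; case: arg_maxnP => // b mb bm; split.
have Il : 'X_[m - U_(l)] \in I.
  have [<- //|il] := eqVneq i l.
  have ltil : (i < l)%N by rewrite ltn_neqAle il lmax.
  have mil : (0 < (m - U_(i))%MM l)%N by rewrite mnmBE mnm1E (negbTE il) subn0.
  (* Replacing x_l by x_i in m/x_i gives m/x_l. *)
  have := borel_memI Ii mil ltil; congr (_ \in I); congr 'X_[_]; apply/mnmP => a.
  rewrite mnmDE !mnmBE !mnm1E.
  case: (i =P a) => [<-|_]; last by rewrite subn0 addn0.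
  by rewrite (eq_sym l) (negbTE il) !subn0 subnK.
have [||g gg pg] := IH (m - U_(l))%MM => //.
  exact: leq_trans (mdeg_sub1_lt ml) dm.
by exists g => //; apply: prefix_trans pg (factors_belast ml lmax).
Qed.

(** Two prefixes of one word are nested, so one generator divides the other. *)
Lemma mingen_prefix m g h : mingen I g -> mingen I h ->
  prefix (factors g) (factors m) -> prefix (factors h) (factors m) -> g = h.
Proof.
move=> gg gh /prefix_colP pg /prefix_colP ph.
have [Ig Ih] : 'X_[g] \in I /\ 'X_[h] \in I by case/andP: gg; case/andP: gh.
have [le|/ltnW le] := leqP (mdeg g) (mdeg h); [|apply/esym].
  apply: (mingen_min gh) => //; apply/prefix_lem/prefix_colP => j jg.
  by rewrite pg // ph // (leq_trans jg).
apply: (mingen_min gg) => //; apply/prefix_lem/prefix_colP => j jg.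
by rewrite ph // pg // (leq_trans jg).
Qed.

Context {d : nat} (hd : forall m : 'X_{1..n}, mingen I m -> (mdeg m <= d)%N).
Local Notation mon := 'X_{1..n < d.+1}.
Local Notation G := (gens I d).

Lemma gensE (m : mon) : (m \in G) = mingen I m.
Proof. by rewrite inE. Qed.

Lemma gpartP m : 'X_[m] \in I ->
  gpart I d m \in G /\ prefix (factors (gpart I d m)) (factors m).
Proof.
move=> Im; rewrite /gpart; case: pickP => [m1 /and3P[gm1 le numu]|no] /=.
  by split; rewrite // -gpart_cond le numu.
have [g gg pg] := prefix_mingen Im.
have dg : (mdeg g < d.+1)%N by rewrite ltnS hd.
by move: (no (BMultinom dg)); rewrite gpart_cond gensE /= gg pg.
Qed.

Lemma borel_step_memI m (i : 'I_n) : 'X_[m] \in I -> (i.+1 < nu m)%N ->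
  'X_[borel_step m i] \in I.
Proof. by move=> Im /borel_stepE[l [_ ml il ->]]; apply: borel_memI. Qed.

(** The point is that m_<i> reaches the altered column: a shorter prefix would be a prefix of m as
    well, hence equal to m by minimality, whereas m has that column. *)
Lemma bracketP (m : mon) (i : 'I_n) : m \in G -> (i.+1 < nu m)%N ->
  [/\ bracket I m i \in G, (mdeg (bracket I m i) <= mdeg m)%N,
      (partial_deg m i < mdeg (bracket I m i))%N &
      forall j, (j < mdeg (bracket I m i))%N ->
        col (bracket I m i) j = if j == partial_deg m i then i : nat else col m j].
Proof.
rewrite gensE => gm im; rewrite /bracket im.
have Im : 'X_[m] \in I by case/andP: gm.
have [gb pb] := gpartP (borel_step_memI Im im).
set b := gpart _ _ _ in gb pb *.
have cb j : (j < mdeg b)%N -> col b j = if j == partial_deg m i then i : nat else col m j.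
  by move=> jb; rewrite (prefix_colP _ _ pb) // borel_step_col.
split=> //.
  by rewrite -(mdeg_borel_step im) -!size_factors; apply: size_prefix.
rewrite ltnNge; apply/negP => le; have Ib : 'X_[b] \in I by move: gb; rewrite gensE => /andP[].
have bm : (b <= m)%MM.
  apply/prefix_lem/prefix_colP => j jb; rewrite cb // ifN // neq_ltn.
  by rewrite (leq_trans jb le).
by move: le im; rewrite (mingen_min gm Ib bm) nu_col leqNgt => /negP.
Qed.

Lemma bracket_uniq (m c : mon) (i : 'I_n) : m \in G -> (i.+1 < nu m)%N -> c \in G ->
  (forall j, (j < mdeg c)%N -> col c j = if j == partial_deg m i then i : nat else col m j) ->
  c = bracket I m i.
Proof.
move=> gm im gc cc; have [gb _ _ cb] := bracketP gm im.
apply/val_inj/(mingen_prefix (m := borel_step m i)); rewrite -?gensE //.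
  by apply/prefix_colP => j jc; rewrite cc // borel_step_col.
by apply/prefix_colP => j jc; rewrite cb // borel_step_col.
Qed.
End BorelIdeal.

(** * Orders and polarized monomials *)

Section StrictTotalOrder.
Context {T : finType} (r : rel T).

Definition strict_total := [/\ irreflexive r, transitive r &
  forall x y, x != y -> r x y || r y x].

Context (rP : strict_total).

Lemma strict_asym x y : r x y -> r y x = false.
Proof. by case: rP => ir tr _ xy; apply/negP => /(tr _ _ _ xy); rewrite ir. Qed.

Lemma strict_neq x y : r x y -> x != y.
Proof. by case: rP => ir _ _; apply: contraTneq => ->; rewrite ir. Qed.

Lemma ex_max (A : {set T}) x : x \in A ->
  exists2 y, y \in A & forall z, z \in A -> (z == y) || r z y.
Proof.
case: rP => ir tr tot xA.
case: (arg_maxnP (fun y => #|[set z in A | r z y]|) xA) => y yA ymax.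
exists y => // z zA; have [//|zy /=] := eqVneq z y.
case/orP: (tot _ _ zy) => // yz; have := ymax z zA; rewrite /= leqNgt => /negP[].
apply: proper_card; apply/properP; split.
  by apply/subsetP => u; rewrite !inE => /andP[-> /tr]; apply.
by exists y; rewrite !inE ?ir ?yz ?andbF ?andbT.
Qed.
End StrictTotalOrder.

Lemma strict_total_sym {T : finType} (r : rel T) :
  strict_total r -> strict_total (fun x y => r y x).
Proof.
case=> ir tr tot; split=> // [y x z yx zy|x y /tot]; first exact: tr zy yx.
by rewrite orbC.
Qed.

Section Sorting.
Context {T : finType} (r : rel T) (rP : strict_total r) (x0 : T) (s : {set T}).
Local Open Scope nat_scope.

Let S := sort (fun x y => (x == y) || r x y) (enum s).

Lemma size_ssort : size S = #|s|.
Proof. by rewrite size_sort cardE. Qed.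

Lemma mem_ssort : S =i s.
Proof. by move=> x; rewrite mem_sort mem_enum. Qed.

Lemma ssort_pairwise : pairwise r S.
Proof.
case: rP => ir tr tot.
have le_total : total (fun x y => (x == y) || r x y).
  by move=> x y; have [->|/tot/orP[]->] := eqVneq x y; rewrite ?orbT.
have: sorted (fun x y => (x == y) || r x y) S by apply: sort_sorted.
rewrite sorted_pairwise; last first.
  by move=> y x z /orP[/eqP->|xy] // /orP[/eqP<-|/(tr _ _ _ xy)->]; rewrite ?xy orbT.
have : uniq S by rewrite sort_uniq enum_uniq.
elim: S => //= x w IH /andP[xw uw] /andP[/allP aw /IH->] //; rewrite andbT.
by apply/allP => y yw; case/predU1P: (aw _ yw) => // xy; rewrite xy yw in xw.
Qed.

Lemma mem_ssort_drop i x : i < #|s| ->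
  (x \in drop i S) = (x \in s) && ((x == nth x0 S i) || r (nth x0 S i) x).
Proof.
move=> lti; rewrite -mem_ssort -{2}(cat_take_drop i S) mem_cat.
move: ssort_pairwise; rewrite -{1}(cat_take_drop i S) pairwise_cat.
rewrite (drop_nth x0) ?size_ssort //= => /and3P[al _ /andP[/allP am _]].
rewrite inE; case: eqP => [->|_] /=; first by rewrite orbT.
case: (boolP (x \in drop _ _)) => [/am ->|_]; first by rewrite orbT.
rewrite orbF; apply/esym/negP => /andP[xt nx].
move/allrelP: al => /(_ _ _ xt (mem_head _ _)) xn.
by rewrite (strict_asym rP xn) in nx.
Qed.
End Sorting.

Lemma bigmax_natP (m n : nat) (P : pred nat) (M := (\max_(m <= l < n | P l) l)%N) :
  ((0 < M)%N -> (m <= M < n)%N /\ P M) /\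
  forall l, (m <= l < n)%N -> P l -> (l <= M)%N.
Proof.
split=> [|l ln Pl]; last first.
  by apply: (@leq_bigmax_seq _ _ P id l) => //; rewrite mem_index_iota.
rewrite /M big_nat_cond.
elim/big_ind: _ => // [a b IHa IHb|l /andP[ln Pl] _]; last by split.
by rewrite /maxn; case: (ltnP a b) => _.
Qed.

Section Polarization.
Context {n d : nat}.
Local Open Scope nat_scope.
Implicit Types (m : 'X_{1..n}) (A B : {set 'I_n * 'I_d}) (p : 'I_n * 'I_d).

(** b-pol(m) is squarefree, so it is encoded by its set of variables; divisibility becomes inclusion
    and lcm becomes union. *)
Definition pset m : {set 'I_n * 'I_d} :=
  [set p : 'I_n * 'I_d | col m p.2 == p.1].
Definition sqfree A : 'X_{1..n * d} := (\sum_(p in A) pvar p)%MM.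

Lemma sqfreeE A p : sqfree A (mxvec_index p.1 p.2) = (p \in A).
Proof.
rewrite /sqfree mnm_sumE; under eq_bigr => q _ do rewrite mnm1E.
have E q : (mxvec_index q.1 q.2 == mxvec_index p.1 p.2) = (q == p).
  case: p q => [a b] [a' b'] /=; apply/eqP/eqP => [|[-> ->] //].
  by case: (curry_mxvec_bij n d) => g gK _ /(congr1 g); rewrite (gK (a', b')) // (gK (a, b)).
have [pA|pA] := boolP (p \in A).
  by rewrite (bigD1 p) //= E eqxx big1 // => q /andP[_ /negbTE]; rewrite E => ->.
by rewrite big1 // => q qA; rewrite E; case: eqP qA pA => // -> ->.
Qed.

Lemma sqfree_le A B : (sqfree A <= sqfree B)%MM = (A \subset B).
Proof.
apply/mnm_lepP/subsetP => [le p|AB i].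
  by move: (le (mxvec_index p.1 p.2)); rewrite !sqfreeE; case: (p \in A) => //; case: (p \in B).
case/mxvec_indexP: i => a b; rewrite (sqfreeE _ (a, b)) (sqfreeE _ (a, b)).
by have := AB (a, b); case: (_ \in A) => // ->.
Qed.

Lemma sqfree_lcm A B : mlcm (sqfree A) (sqfree B) = sqfree (A :|: B).
Proof.
apply/mnmP => i; case/mxvec_indexP: i => a b; rewrite mnmE !(sqfreeE _ (a, b)) inE.
by case: (_ \in A); case: (_ \in B).
Qed.

Lemma sqfree0 : sqfree set0 = 0%MM.
Proof. by rewrite /sqfree big_set0. Qed.

Lemma bpolE m : bpol d m = sqfree (pset m).
Proof. by apply: eq_bigl => p; rewrite inE onth_factors. Qed.

Definition lset (s : {set 'X_{1..n < d.+1}}) := \bigcup_(m in s) pset m.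

Lemma lcmsetE (s : {set 'X_{1..n < d.+1}}) : lcmset s = sqfree (lset s).
Proof.
rewrite /lcmset /lset; elim/big_ind2: _ => [|? A ? B -> ->|m _].
- by rewrite sqfree0.
- exact: sqfree_lcm.
- exact: bpolE.
Qed.

Lemma bpol_le_lcmset m (s : {set 'X_{1..n < d.+1}}) : (bpol d m <= lcmset s)%MM = (pset m \subset lset s).
Proof. by rewrite bpolE lcmsetE sqfree_le. Qed.

Lemma lset_sub (s t : {set 'X_{1..n < d.+1}}) : s \subset t -> lset s \subset lset t.
Proof. by move/subsetP => st; apply/bigcupsP => m /st ms; apply: bigcup_sup. Qed.

Lemma mem_lset (s : {set 'X_{1..n < d.+1}}) p : reflect (exists2 m, m \in s & p \in pset m) (p \in lset s).
Proof. exact: bigcupP. Qed.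

Lemma pset_ltn m p : p \in pset m -> p.2 < mdeg m.
Proof. by rewrite inE -col_ltn => /eqP->. Qed.

Lemma pset_at m j : j < mdeg m -> mdeg m <= d ->
  exists p, [/\ p \in pset m, p.1 = col m j :> nat & p.2 = j :> nat].
Proof.
move=> jm md; have jn : col m j < n by rewrite col_ltn.
by exists (Ordinal jn, Ordinal (leq_trans jm md)); rewrite inE.
Qed.

Lemma pset_sub m m' : mdeg m <= d -> pset m \subset pset m' ->
  prefix (factors m) (factors m').
Proof.
move=> md /subsetP sub; apply/prefix_colP => j jm.
have [p [pm p1 p2]] := pset_at jm md.
by have := sub _ pm; rewrite inE p2 p1 => /eqP.
Qed.

Lemma lexgt_total m m' : m != m' -> lexgt m m' || lexgt m' m.
Proof.
move=> mm'; have [i0 ne0] : exists i, m i != m' i.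
  apply/existsP; apply: contraR mm' => /existsPn eq; apply/eqP/mnmP => i.
  by apply/eqP; rewrite -[_ == _]negbK.
case: (arg_minnP (fun i : 'I_n => i : nat) (P := fun i => m i != m' i) ne0) => i nei imin.
have eqi (l : 'I_n) : l < i -> m l == m' l.
  by apply: contraTT => /imin; rewrite -leqNgt.
apply/orP; move: nei; rewrite neq_ltn => /orP[lt|lt]; [right|left];
  apply/existsP; exists i; rewrite lt; apply/forallP => l; apply/implyP => /eqi //.
by rewrite eq_sym.
Qed.

(** Let i be the first exponent that differs. In column [partial_deg m' i] the monomial m still has
    the letter i, while m' has passed to a larger letter or has ended; the default value of [col]
    covers the latter. *)
Lemma lexgt_col m m' : lexgt m m' -> exists2 j, col m j < col m' j &
  forall j', j' < j -> col m j' = col m' j'.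
Proof.
case/existsP=> i /andP[lt /forallP eqm].
have eql (l : 'I_n) : l < i -> m l = m' l by move=> li; apply/eqP; move/implyP: (eqm l); apply.
have eqpd (l : 'I_n) : l < i -> partial_deg m l = partial_deg m' l.
  by move=> li; apply: eq_bigr => a al; rewrite eql // (leq_ltn_trans al).
have ltpd : partial_deg m' i < partial_deg m i.
  rewrite /partial_deg (bigD1 i) // [X in _ < X](bigD1 i) //= -addSn leq_add // leq_eqVlt.
  apply/orP; left; apply/eqP/eq_bigr => a /andP[ai ne]; rewrite eql //.
  by rewrite ltn_neqAle ne.
exists (partial_deg m' i) => [|j' lt'].
  by apply: (@leq_ltn_trans i); rewrite -?partial_deg_col // ltnNge -partial_deg_col ltnn.
have le1 : col m' j' <= i by rewrite -partial_deg_col.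
have le2 : col m j' <= i by rewrite -partial_deg_col (ltn_trans lt').
(* Both letters are at most i and compare alike with every letter below i, so they agree. *)
have H l : l < i -> (col m j' <= l) = (col m' j' <= l).
  move=> li; have ln := ltn_trans li (ltn_ord i).
  by rewrite -!(partial_deg_col _ (Ordinal ln)) eqpd.
apply/anti_leq/andP; split; rewrite leqNgt; apply/negP => lt2.
  by have := H _ (leq_trans lt2 le2); rewrite leqnn leqNgt lt2.
by have := H _ (leq_trans lt2 le1); rewrite leqnn leqNgt lt2.
Qed.

Lemma lexgtP m m' : reflect (exists2 j, col m j < col m' j &
  forall j', j' < j -> col m j' = col m' j') (lexgt m m').
Proof.
apply: (iffP idP) => [/lexgt_col //|[j lt eqj]].
have: m != m' by apply: contraTneq lt => ->; rewrite ltnn.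
case/lexgt_total/orP=> // /lexgt_col[j2 lt2 eqj2].
have [jj|jj|jj] := ltngtP j j2.
- by move: lt; rewrite eqj2 // ltnn.
- by move: lt2; rewrite eqj // ltnn.
- by move: lt2; rewrite -jj ltnNge ltnW.
Qed.

Lemma before_strict : strict_total (fun m m' : 'X_{1..n < d.+1} => before m m').
Proof.
split=> [m|m2 m1 m3|m m' mm'] /=.
- by rewrite /before; apply/negbTE/lexgtP => -[j]; rewrite ltnn.
- rewrite /before; case/lexgtP=> j lt eqj /lexgtP[j' lt' eqj']; apply/lexgtP.
  have [jj|jj|jj] := ltngtP j j'.
  + exists j => [|a aj]; first by rewrite -eqj'.
    by rewrite eqj // eqj' // (ltn_trans aj).
  + exists j' => [|a aj]; first by rewrite eqj.
    by rewrite eqj ?eqj' // (ltn_trans aj).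
  + subst j'; exists j => [|a aj]; first exact: ltn_trans lt'.
    by rewrite eqj // eqj'.
- exact: lexgt_total.
Qed.
End Polarization.

(** * The Batzies-Welker matching *)

Section BatziesWelkerMatching.
Context {k : fieldType} {n d : nat} (I : {pred {mpoly k[n]}}) (hI : borel_fixed I).
Context (hd : forall m : 'X_{1..n}, mingen I m -> (mdeg m <= d)%N).
Local Open Scope nat_scope.
Local Notation mon := 'X_{1..n < d.+1}.
Local Notation vertex := {set mon}.
Local Notation G := (gens I d).
Local Notation pset := (@pset n d).
Implicit Types (m x y : mon) (s t : vertex) (i : 'I_n).

Lemma mon_deg m : mdeg m <= d.
Proof. by rewrite -ltnS bmdeg. Qed.

Lemma gens_antichain m x : m \in G -> x \in G -> pset m \subset pset x -> m = x.
Proof.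
rewrite !gensE => gm gx /(pset_sub (mon_deg m))/prefix_lem le.
by apply/val_inj/(mingen_min gx) => //; case/andP: gm.
Qed.

Lemma bracket_before m i : m \in G -> i.+1 < nu m -> before (bracket I m i) m.
Proof.
move=> gm im; have [gb _ pb cb] := bracketP hI hd gm im.
apply/lexgtP; exists (partial_deg m i) => [|j jp].
  by rewrite cb // eqxx ltnNge -partial_deg_col ltnn.
by rewrite cb ?(ltn_trans jp) // (ltn_eqF jp).
Qed.

Lemma topP s : s != set0 ->
  top s \in s /\ forall x, x \in s -> (x == top s) || before x (top s).
Proof.
case/set0Pn => x xs; have [y ys ymax] := ex_max before_strict xs.
rewrite /top; case: pickP => [z /andP[zs /forall_inP zmax] //|/(_ y)].
by rewrite ys /= => /negP[]; apply/forall_inP.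
Qed.

Lemma top_eq s m : m \in s -> (forall x, x \in s -> (x == m) || before x m) ->
  top s = m.
Proof.
move=> ms mmax; have [|ts tmax] := @topP s; first by apply/set0Pn; exists m.
case/predU1P: (mmax _ ts) => // tm; case/predU1P: (tmax _ ms) => // mt.
by rewrite (strict_asym before_strict tm) in mt.
Qed.

Lemma NsetP s x : reflect
  (exists i, [/\ i.+1 < nu (top s), pset (bracket I (top s) i) \subset lset s
               & x = bracket I (top s) i])
  (x \in Nset I s).
Proof.
apply: (iffP imsetP) => [[i]|[i [ti sub ->]]].
  by rewrite inE bpol_le_lcmset => /andP[ti sub] ->; exists i.
by exists i; rewrite // inE bpol_le_lcmset ti.
Qed.

Lemma sbefore_strict s : strict_total (sbefore I s).
Proof.
have [ir tr tot] := @before_strict n d; split=> [x|y x z|x y xy].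
- by rewrite /sbefore eqxx ir.
- rewrite /sbefore; case: (x \in _); case: (y \in _); case: (z \in _) => //=; exact: tr.
- by rewrite /sbefore; case: (x \in _); case: (y \in _) => //=; apply: tot.
Qed.

Lemma vertex_top s : isvertex I s -> top s \in s /\ top s \in G.
Proof. by case/andP=> /topP[ts _] /subsetP sG; split=> //; apply: sG. Qed.

Lemma Nset_before s x : isvertex I s -> x \in Nset I s -> before x (top s).
Proof. by case/vertex_top=> _ tG /NsetP[i [ti _ ->]]; apply: bracket_before. Qed.

Lemma top_notin_Nset s : isvertex I s -> top s \notin Nset I s.
Proof.
move=> vs; apply/negP => /(Nset_before vs).
by have [ir _ _] := @before_strict n d; rewrite ir.
Qed.

Lemma sbefore_top s x : isvertex I s -> sbefore I s x (top s) = before x (top s).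
Proof.
move=> vs; rewrite /sbefore (negbTE (top_notin_Nset vs)) eqbF_neg.
by case: (boolP (x \in Nset I s)) => //= /(Nset_before vs).
Qed.

Lemma sbefore_topP s x : isvertex I s -> x \in s ->
  (x == top s) || sbefore I s x (top s).
Proof.
by move=> vs xs; rewrite sbefore_top //; case/andP: vs => /topP[_ tmax] _; apply: tmax.
Qed.

Definition above s m : vertex := [set x in s | sbefore I s m x].

(* u(s) <> -oo iff [Dset s] is nonempty, and then n_s is its least element.  The
   clause [sbefore I s m (top s)] only matters when G = {1}. *)
Definition Dset s : vertex :=
  [set m in G | sbefore I s m (top s) && (pset m \subset lset (above s m))].

Lemma DsetP s m : reflect
  [/\ m \in G, sbefore I s m (top s) & pset m \subset lset (above s m)]
  (m \in Dset s).
Proof. by rewrite [X in reflect _ X]inE; apply: and3P. Qed.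

Lemma mem_stail s l x : l < #|s| ->
  (x \in stail I s l) = (x \in s) && ((x == selem I s l) || sbefore I s (selem I s l) x).
Proof.
move=> ls; rewrite inE; apply: mem_ssort_drop; first exact: sbefore_strict.
by rewrite ltn_subrL /= (leq_ltn_trans _ ls).
Qed.

Lemma mem_selem s l : l < #|s| -> selem I s l \in s.
Proof.
move=> ls; rewrite -(mem_ssort (sbefore I s)); apply: mem_nth.
by rewrite size_ssort ltn_subrL /= (leq_ltn_trans _ ls).
Qed.

Lemma stail_mono s l l' : l <= l' -> stail I s l \subset stail I s l'.
Proof.
move=> ll; apply/subsetP => x; rewrite !inE.
have le : #|s| - l'.+1 <= #|s| - l.+1 by rewrite leq_sub2l.
by rewrite -(subnK le) -drop_drop; apply: mem_drop.
Qed.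

Definition ucond s l := [exists m in G,
  sbefore I s m (selem I s l) && (bpol d m <= lcmset (stail I s l))%MM].

Lemma ucondP s l : reflect
  (exists m, [/\ m \in G, sbefore I s m (selem I s l) & pset m \subset lset (stail I s l)])
  (ucond s l).
Proof.
apply: (iffP exists_inP) => [[m mG /andP[]]|[m [mG lt sub]]].
  by rewrite bpol_le_lcmset; exists m.
by exists m => //; rewrite lt bpol_le_lcmset.
Qed.

(** If p is the least element of s after m, the tail of s from p on is [above s m]. So m witnesses
    the condition on u(s) at the position of p, and the tail at the supremum contains this one. *)
Lemma Dset_uval s m : isvertex I s -> m \in Dset s ->
  0 < uval I s /\ pset m \subset lset (stail I s (uval I s)).
Proof.
move=> vs /DsetP[mG lt sub]; have [ts tG] := vertex_top vs.
have sP := sbefore_strict s; have [_ tr _] := sP.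
have tA : top s \in above s m by rewrite inE ts.
have [p pA pmin] := ex_max (strict_total_sym sP) tA.
move: (pA); rewrite inE => /andP[ps mp].
have: p \in sort (fun x y => (x == y) || sbefore I s x y) (enum s) by rewrite mem_ssort.
case/(nthP bm0) => ip; rewrite size_ssort => ltip pE.
pose l := #|s| - ip.+1.
have ls : l < #|s| by rewrite /l ltn_subrL /= (leq_ltn_trans _ ltip).
have selp : selem I s l = p by rewrite -pE /selem /senum /l subnSK // subKn // ltnW.
have tailE : stail I s l = above s m.
  apply/setP => x; rewrite mem_stail // selp inE; case: (boolP (x \in s)) => //= xs.
  apply/orP/idP => [[/eqP->//|/(tr _ _ _ mp)//]|mx].
  by apply/orP; apply: pmin; rewrite inE xs.
(* At position 0 the generator m would divide the top alone, hence equal it, although it comes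
   strictly before. *)
have l0 : 0 < l.
  rewrite lt0n; apply/negP => /eqP l0.
  suff E : above s m = [set top s].
    move: sub; rewrite E /lset big_set1 => /(gens_antichain mG tG) mt.
    by move: lt; rewrite mt; case: sP => ir _ _; rewrite ir.
  have card1 : #|above s m| <= 1.
    rewrite -tailE /stail cardsE; apply: leq_trans (card_size _) _.
    by rewrite size_drop size_ssort l0 subn1 leq_subLR addn1 -ltnS prednK // (leq_ltn_trans _ ltip).
  apply/esym/eqP; rewrite eqEcard sub1set tA cards1 //.
have Pl : ucond s l by apply/ucondP; exists m; rewrite selp tailE.
have [_ umax] := bigmax_natP 1 #|s| (ucond s).
have lu : l <= uval I s by apply: umax => //; rewrite l0.
split; first exact: leq_trans lu.
by apply: subset_trans sub _; rewrite -tailE lset_sub ?stail_mono.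
Qed.

(** n_s is the minimum over the divisors of the lcm of the tail at u(s). These include [Dset s], and
    the minimum belongs to [Dset s] because it precedes the whole tail. *)
Lemma nmin_spec s : isvertex I s -> 0 < uval I s ->
  nmin I s \in Dset s /\
  forall m, m \in Dset s -> (m == nmin I s) || sbefore I s (nmin I s) m.
Proof.
move=> vs u0; have sP := sbefore_strict s; have [ir tr _] := sP.
have [/(_ u0)[/andP[_ us] /ucondP[m0 [m0G lt0 sub0]]] _] := bigmax_natP 1 #|s| (ucond s).
rewrite -/(uval I s) in us lt0 sub0.
pose D := [set m in G | (bpol d m <= lcmset (stail I s (uval I s)))%MM].
have m0D : m0 \in D by rewrite inE m0G bpol_le_lcmset.
have [y yD ymin] := ex_max (strict_total_sym sP) m0D.
have [nD nmin_le] : nmin I s \in D /\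
    forall m, m \in D -> (m == nmin I s) || sbefore I s (nmin I s) m.
  rewrite /nmin -/D; case: pickP => [z /andP[zD /forall_inP zmin] //|/(_ y)].
  by rewrite yD /= => /negP[]; apply/forall_inP.
split=> [|m mD]; last first.
  have [_ sub] := Dset_uval vs mD; apply: nmin_le.
  by rewrite inE bpol_le_lcmset sub andbT; case/DsetP: mD.
have lts : sbefore I s (nmin I s) (selem I s (uval I s)).
  by case/predU1P: (nmin_le _ m0D) => [<-//|/tr]; apply.
move: nD; rewrite inE bpol_le_lcmset => /andP[nG sub]; apply/DsetP; split=> //.
  by case/predU1P: (sbefore_topP vs (mem_selem us)) => [<-//|]; apply: tr lts.
apply: subset_trans sub _; apply/lset_sub/subsetP => x.
rewrite mem_stail // inE => /andP[-> /=]; case/predU1P=> [->//|].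
exact: tr lts.
Qed.

Lemma uval_gt0 s : isvertex I s -> (0 < uval I s) = (Dset s != set0).
Proof.
move=> vs; apply/idP/set0Pn => [/(nmin_spec vs)[nD _]|[m /(Dset_uval vs)[] //]].
by exists (nmin I s).
Qed.
End BatziesWelkerMatching.

(** * Acyclicity of the matching *)

Lemma lex_enc_ltn N a b a' b' : (b <= N)%N ->
  (a < a')%N || (a == a') && (b < b')%N -> (a * N.+1 + b < a' * N.+1 + b')%N.
Proof. by move=> bN /orP[|/andP[/eqP-> ?]]; nia. Qed.

Section MatchingTheory.
Context {k : fieldType} {n d : nat} (I : {pred {mpoly k[n]}}) (hI : borel_fixed I).
Context (hd : forall m : 'X_{1..n}, mingen I m -> (mdeg m <= d)%N).
Local Open Scope nat_scope.
Local Notation mon := 'X_{1..n < d.+1}.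
Local Notation vertex := {set mon}.
Local Notation G := (gens I d).
Local Notation pset := (@pset n d).
Implicit Types (m x y : mon) (s t : vertex) (i : 'I_n).

Lemma sbefore_congr s t : top s = top t -> lset s = lset t ->
  sbefore I s =2 sbefore I t.
Proof.
move=> ts ls x y; suff E : Nset I s = Nset I t by rewrite /sbefore E.
by apply/setP => z; apply/NsetP/NsetP; rewrite ts ls.
Qed.

Lemma matchedE t s : matched I t s =
  [&& isvertex I s, Dset I s != set0, nmin I s \notin s & t == nmin I s |: s].
Proof. by rewrite /matched; case: (boolP (isvertex I s)) => //= vs; rewrite uval_gt0. Qed.

(* Otherwise the conversion tests of [done] evaluate these choices. *)
Local Opaque top nmin uval Nset bracket gens Dset lset sbefore before.

Lemma nminP s : isvertex I s -> Dset I s != set0 ->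
  nmin I s \in Dset I s /\
  forall m, m \in Dset I s -> (m == nmin I s) || sbefore I s (nmin I s) m.
Proof. by move=> vs D0; apply: nmin_spec; rewrite // uval_gt0. Qed.

Lemma nmin_eq s m : isvertex I s -> m \in Dset I s ->
  (forall x, x \in Dset I s -> (x == m) || sbefore I s m x) -> nmin I s = m.
Proof.
move=> vs mD mmin; have [|nD nle] := nminP vs; first by apply/set0Pn; exists m.
case/predU1P: (mmin _ nD) => // mn; case/predU1P: (nle _ mD) => // nm.
by rewrite (strict_asym (sbefore_strict I s) mn) in nm.
Qed.

Lemma lsetU1 m s : lset (m |: s) = pset m :|: lset s.
Proof.
apply/setP => p; rewrite inE; apply/mem_lset/orP => [[x]|[pm|/mem_lset[x xs px]]].
- by rewrite in_setU1 => /predU1P[->|xs] px; [left | right; apply/mem_lset; exists x].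
- by exists m; rewrite // setU11.
- by exists x; rewrite // setU1r.
Qed.

(** The inclusions cover insertion and deletion of n_s at once. It divides the lcm of the elements
    above it, so the toggle changes neither lcm nor order. A candidate m for t before n_s may have
    n_s among the elements above it, but those above n_s replace it there, so m is a candidate for
    s, against minimality. *)
Lemma toggle_nmin s t : isvertex I s -> Dset I s != set0 ->
  s :\ nmin I s \subset t -> t \subset nmin I s |: s ->
  [/\ isvertex I t, top t = top s, lset t = lset s, nmin I s \in Dset I t
    & nmin I t = nmin I s].
Proof.
move=> vs D0; have [] := nminP vs D0; set v := nmin I s => vD vmin st tv.
have sP := sbefore_strict I s; have [ir tr tot] := sP.
have [vG vtop vsub] := DsetP _ _ _ vD.
have [ts tG] := vertex_top vs.
have vnt : v != top s := strict_neq sP vtop.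
have tt : top s \in t by apply: (subsetP st); rewrite !inE eq_sym vnt.
have vt : isvertex I t.
  apply/andP; split; first by apply/set0Pn; exists (top s).
  apply/subsetP => x /(subsetP tv); rewrite !inE => /predU1P[->|] //.
    by rewrite -gensE.
  by case/andP: vs => _ /subsetP sG /sG; rewrite gensE.
have toptE : top t = top s.
  apply: top_eq => // x /(subsetP tv); rewrite !inE => /predU1P[->|xs].
    by rewrite -(sbefore_top hI hd) // vtop orbT.
  by case/andP: vs => /topP[_ tmax] _; apply: tmax.
have vabove : above I s v \subset s :\ v.
  apply/subsetP => x; rewrite !inE => /andP[-> lt]; rewrite andbT eq_sym.
  by apply: contraTneq lt => <-; rewrite ir.
have lsvE : lset (s :\ v) = lset s.
  apply/eqP; rewrite eqEsubset lset_sub ?subD1set //=.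
  have: lset s \subset lset (v |: (s :\ v)).
    by apply: lset_sub; apply/subsetP => x; rewrite !inE; case: eqP.
  move/subset_trans; apply; rewrite lsetU1 subUset subxx andbT.
  exact: subset_trans vsub (lset_sub vabove).
have lsE : lset t = lset s.
  apply/eqP; rewrite eqEsubset -{2}lsvE (lset_sub st) andbT.
  apply: subset_trans (lset_sub tv) _; rewrite lsetU1 subUset subxx andbT -lsvE.
  exact: subset_trans vsub (lset_sub vabove).
have sbE := sbefore_congr toptE lsE.
have vDt : v \in Dset I t.
  apply/DsetP; split=> //; first by rewrite sbE toptE.
  apply: subset_trans vsub (lset_sub _); apply/subsetP => x.
  rewrite !inE sbE => /andP[xs lt]; rewrite lt andbT; apply: (subsetP st).
  by rewrite !inE xs eq_sym (strict_neq sP lt).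
split; [exact: vt | exact: toptE | exact: lsE | exact: vDt |].
apply: nmin_eq; [exact: vt | exact: vDt |] => m /DsetP[mG mtop msub].
have [//|mv] := eqVneq m v; rewrite sbE /=; case/orP: (tot _ _ mv) => // lt.
suff mD : m \in Dset I s by case/predU1P: (vmin _ mD) => // mE; rewrite mE eqxx in mv.
apply/DsetP; split; rewrite -?toptE -?sbE //.
apply: subset_trans msub _.
have: lset (above I t m) \subset lset (v |: above I s m).
  apply/lset_sub/subsetP => x; rewrite !inE sbE => /andP[/(subsetP tv)].
  by rewrite !inE => /predU1P[->|->] lt'; rewrite ?eqxx // lt' orbT.
move/subset_trans; apply; rewrite lsetU1 subUset subxx andbT.
apply: subset_trans vsub (lset_sub _); apply/subsetP => x.
by rewrite !inE => /andP[-> /(tr _ _ _ lt)].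
Qed.

Lemma matchedP t s : matched I t s ->
  [/\ isvertex I s /\ isvertex I t, top t = top s, lset t = lset s,
      [/\ Dset I s != set0, Dset I t != set0 & nmin I t = nmin I s] &
      nmin I s \notin s /\ t = nmin I s |: s].
Proof.
rewrite matchedE => /and4P[vs D0 ns /eqP->].
have [||vt tt lt nD nE] := @toggle_nmin s (nmin I s |: s) vs D0.
- exact: subset_trans (subD1set _ _) (subsetUr _ _).
- exact: subxx.
split; [exact: conj vs vt | exact: tt | exact: lt | | exact: conj ns erefl].
by split; [exact: D0 | apply/set0Pn; exists (nmin I s) | exact: nE].
Qed.

Lemma matched_edge t s : matched I t s -> edge I t s.
Proof.
case/matchedP=> -[vs vt] _ _ _ [ns tE].
by rewrite /edge vs vt tE subsetUr cardsU1 ns add1n eqxx.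
Qed.

Lemma matched_funl t t' s : matched I t s -> matched I t' s -> t = t'.
Proof. by case/matchedP=> _ _ _ _ [_ ->] /matchedP[_ _ _ _ [_ ->]]. Qed.

(** As n_t = n_s, the smaller end is recovered by removing n_t from t. *)
Lemma matched_funr t s s' : matched I t s -> matched I t s' -> s = s'.
Proof.
case/matchedP=> _ _ _ [_ _ nE] [ns tE] /matchedP[_ _ _ [_ _ nE'] [ns' tE']].
rewrite -(setU1K ns) -tE -nE nE' {1}tE' setU1K //.
Qed.

Lemma matched_alt t s r : matched I t s -> matched I s r = false.
Proof.
case/matchedP=> _ _ _ _ [ns _]; apply/negP => /matchedP[_ _ _ [_ _ nE] [_ sE]].
by case/negP: ns; rewrite nE sE setU11.
Qed.

(** A substitute for n_s that makes sense when n_s does not exist (it is then empty) and is monotone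
    in [Dset s]. *)
Definition upset s : vertex :=
  [set x | [exists m in Dset I s, (m == x) || sbefore I s m x]].

Lemma upset_nmin s : isvertex I s -> Dset I s != set0 ->
  upset s = [set x | (x == nmin I s) || sbefore I s (nmin I s) x].
Proof.
move=> vs D0; have [nD nle] := nminP vs D0; have [_ tr _] := sbefore_strict I s.
apply/setP => x; rewrite !inE; apply/exists_inP/idP => [[m /nle]|].
  case/predU1P=> [->|lt] /predU1P[<-|lt'].
  - by rewrite eqxx.
  - by rewrite lt' orbT.
  - by rewrite lt orbT.
  - by rewrite (tr _ _ _ lt lt') orbT.
by move=> xn; exists (nmin I s) => //; rewrite eq_sym.
Qed.

(* Along a path the top and the lcm never increase.  While they are constant the
   order is fixed and n_s, hence the complement of [upset s], can only grow; and
   while n_s is constant too, it is inserted at most once. *)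
Definition below_top s := #|[set x | before x (top s)]|.
(** The bonus is two because inserting n_s costs one in cardinality. *)
Definition toggle_rank s := #|s| + ((Dset I s != set0) && (nmin I s \notin s)).*2.
(** A number with four digits; each multiplier exceeds the largest value of the digit added after
    it. *)
Definition mrank s :=
  ((below_top s * (n * d).+1 + #|lset s|) * #|{: mon}|.+1 + #|upset s|) *
    #|{: mon}|.+3 + toggle_rank s.

Lemma mrank_ltn s t :
  [|| below_top t < below_top s,
      (below_top t == below_top s) && (#|lset t| < #|lset s|) |
      [&& below_top t == below_top s, #|lset t| == #|lset s| &
        (#|upset t| < #|upset s|) ||
        (#|upset t| == #|upset s|) && (toggle_rank t < toggle_rank s)]] ->
  mrank t < mrank s.
Proof.
have l1 : #|lset t| <= n * d by rewrite (leq_trans (max_card _)) // card_prod !card_ord.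
have l2 : #|upset t| <= #|{: mon}| by apply: max_card.
have l3 : toggle_rank t <= #|{: mon}|.+2.
  by rewrite -addn2 leq_add ?max_card //; case: (_ && _).
move=> lt; apply: lex_enc_ltn => //.
have [lt1|E1] : (below_top t < below_top s) || (below_top t == below_top s) && (#|lset t| < #|lset s|) \/
  (below_top t = below_top s /\ #|lset t| = #|lset s|).
- by case/or3P: lt => [->|->|/and3P[/eqP-> /eqP->]]; [left|left; rewrite orbT|right].
- by apply/orP; left; apply: lex_enc_ltn => //; apply/orP; left; apply: lex_enc_ltn.
case: E1 => E1 E2; rewrite E1 E2.
case/or3P: lt => [lt|/andP[_ lt]|/and3P[_ _ lt]].
- by rewrite E1 ltnn in lt.
- by rewrite E2 ltnn in lt.
case/orP: lt => [lt|/andP[/eqP-> ->]]; last by rewrite eqxx orbT.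
by apply/orP; left; rewrite ltn_add2l.
Qed.

(** An insertion changes the last digit only. A deletion keeping the first three digits keeps n_s
    whenever [Dset t] is nonempty; then only the deletion of n_s itself could fail to lower the last
    digit, and that edge is matched, so it is not a downward step. *)
Lemma medge_mrank s t : medge I s t -> mrank t < mrank s.
Proof.
case/orP=> [/andP[/and4P[vs vt ts /eqP cs] nm]|]; last first.
  case/matchedP=> -[vs vt] tE lE [Ds Dt nE] [ns st]; apply: mrank_ltn.
  have uE : upset t = upset s.
    rewrite (upset_nmin vt Dt) (upset_nmin vs Ds) nE.
    by apply/setP => x; rewrite !inE (sbefore_congr tE lE).
  apply/or3P; constructor 3; apply/and3P; split.
  - by rewrite /below_top tE.
  - by rewrite lE.
  rewrite uE ltnn eqxx /= /toggle_rank Ds Dt nE ns st setU11 cardsU1 ns /=.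
  by rewrite addn0 add1n addn2.
have [tops topG] := vertex_top vs; have [topt _] := vertex_top vt.
have [/andP[s0 _]] := (vs); have [_ tmax] := topP s0.
have cs' : #|t| < #|s| by rewrite cs.
have [tE|lt] := predU1P (tmax _ (subsetP ts _ topt)); last first.
  apply: mrank_ltn; apply/or3P; constructor 1; apply: proper_card; apply/properP; split.
    apply/subsetP => x; rewrite !inE => ltx.
    by have [_ tr _] := @before_strict n d; apply: tr ltx lt.
  by exists (top t); rewrite !inE //; have [-> ] := @before_strict n d.
have lsub := lset_sub ts.
have [lE|lne] := eqVneq (lset t) (lset s); last first.
  apply: mrank_ltn; apply/or3P; constructor 2; rewrite /below_top tE eqxx /=.
  by apply: proper_card; rewrite properEneq lne.
have sbE := sbefore_congr tE lE; have sP := sbefore_strict I s.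
have Dsub : Dset I t \subset Dset I s.
  apply/subsetP => m /DsetP[mG mt sub]; apply/DsetP; split; rewrite -?tE -?sbE //.
  apply: subset_trans sub (lset_sub _); apply/subsetP => x.
  by rewrite !inE sbE => /andP[/(subsetP ts)-> ->].
have usub : upset t \subset upset s.
  apply/subsetP => x; rewrite !inE => /exists_inP[m mD mx]; apply/exists_inP.
  by exists m; rewrite ?(subsetP Dsub) // -sbE.
have [uE|une] := eqVneq (upset t) (upset s); last first.
  apply: mrank_ltn; apply/or3P; constructor 3; apply/and3P; split.
  - by rewrite /below_top tE.
  - by rewrite lE.
  - by apply/orP; left; apply: proper_card; rewrite properEneq une.
apply: mrank_ltn; apply/or3P; constructor 3; apply/and3P; split.
- by rewrite /below_top tE.
- by rewrite lE.
rewrite uE eqxx ltnn /= /toggle_rank; have [Dt|Dt] := eqVneq (Dset I t) set0.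
  by rewrite addn0 (leq_trans cs') ?leq_addr.
have Ds : Dset I s != set0 by apply: contraNneq Dt => Ds; move: Dsub; rewrite Ds subset0.
have [ns nsle] := nminP vs Ds; have [nt ntle] := nminP vt Dt.
have nE : nmin I t = nmin I s.
  case/predU1P: (nsle _ (subsetP Dsub _ nt)) => // lt.
  have: nmin I s \in upset t by rewrite uE upset_nmin // inE eqxx.
  rewrite upset_nmin // inE => /predU1P[->//|]; rewrite sbE.
  by rewrite (strict_asym sP lt).
rewrite Ds nE /=; have [nint|nint] := boolP (nmin I s \in t).
  by rewrite (subsetP ts) // !addn0.
have [nins|nins] := boolP (nmin I s \in s); last by rewrite ltn_add2r.
case/negP: nm; rewrite matchedE vt Dt nE nint /= eq_sym eqEcard subUset sub1set nins ts /=.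
by rewrite cardsU1 nint cs.
Qed.
End MatchingTheory.

(** * The Morse complex of the matching *)

Section MorseComplex.
Context {k : fieldType} {n d : nat} (I : {pred {mpoly k[n]}}) (hI : borel_fixed I).
Context (hd : forall m : 'X_{1..n}, mingen I m -> (mdeg m <= d)%N).
Local Notation mon := 'X_{1..n < d.+1}.
Local Notation vertex := {set mon}.
Local Notation G := (gens I d).
Local Notation pset := (@pset n d).
Local Notation St := {mpoly k[n * d]}.
Implicit Types (m x y : mon) (s t r u : vertex) (i : 'I_n).

Definition srank s m := #|[set x in s | (x == m) || before x m]|.

Lemma incidence_del s m : m \in s -> incidence s (s :\ m) = (-1) ^+ srank s m :> St.
Proof.
move=> ms; rewrite /incidence (big_pred1 m) // => x; rewrite !inE negb_and negbK.
by case: eqP => [->|_] /=; rewrite ?ms // andNb.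
Qed.

Lemma incidence_sq s t : incidence s t * incidence s t = 1 :> St.
Proof.
rewrite /incidence -big_split big1 //= => m _.
by rewrite -exprD addnn -mul2n exprM sqrrN !expr1n.
Qed.

Lemma srank_del_lt s x y : x \in s -> before x y ->
  srank s y = (srank (s :\ x) y).+1.
Proof.
move=> xs xy; rewrite /srank (cardsD1 x) !inE xs xy orbT add1n; congr _.+1.
by apply: eq_card => z; rewrite !inE andbA.
Qed.

Lemma srank_del_gt s x y : before x y -> srank (s :\ y) x = srank s x.
Proof.
move=> xy; apply: eq_card => z; rewrite !inE; case: eqP => //= ->.
rewrite (strict_asym before_strict xy) orbF; case: eqP xy => [->|]; rewrite ?andbF //.
by have [-> _ _] := @before_strict n d.
Qed.

(** The simplicial identity: r has two intermediate faces, and deleting the smaller missing element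
    first shifts the rank of the larger one. *)
Lemma incidence_incidence s r :
  \sum_(t | edge I s t && edge I t r) incidence s t * incidence t r = 0 :> St.
Proof.
case: (pickP (fun t => edge I s t && edge I t r)) => [t0|no]; last by rewrite big_pred0.
case/andP=> /and4P[vs _ ts /eqP cs] /and4P[vt vr rt /eqP ct].
have rs := subset_trans rt ts.
have : #|s :\: r| == 2 by rewrite cardsD (setIidPr rs) cs ct -addn2 addKn.
case/cards2P=> a [b [ab sr]].
have {t0 ts rt vt cs ct} cs : #|s| = #|r|.+2 by rewrite cs ct.
wlog lt : a b ab sr / before a b.
  move=> H; have [_ _ tot] := @before_strict n d.
  case/orP: (tot _ _ ab) => lt; first exact: H sr lt.
  by apply: (H b a) => //; rewrite 1?eq_sym // setUC.
have inD x : (x \in s) && (x \notin r) = (x == a) || (x == b).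
  by have := congr1 (fun A : vertex => x \in A) sr; rewrite !inE andbC.
have /andP[as_ ar] : (a \in s) && (a \notin r) by rewrite inD eqxx.
have /andP[bs br] : (b \in s) && (b \notin r) by rewrite inD eqxx orbT.
have rE x y : x != y -> (x == a) || (x == b) -> (y == a) || (y == b) -> r = (s :\ x) :\ y.
  move=> xy xab yab; apply/eqP; rewrite eqEcard; apply/andP; split.
    apply/subsetP => z zr; rewrite !inE (subsetP rs) // andbT.
    by apply/andP; split; apply: contraTneq zr => ->; [have := inD y; rewrite yab => /andP[] | have := inD x; rewrite xab => /andP[]].
  have xs : x \in s by have := inD x; rewrite xab => /andP[].
  have ys : y \in s by have := inD y; rewrite yab => /andP[].
  have := cardsD1 x s; rewrite xs (cardsD1 y (s :\ x)) !inE ys eq_sym xy cs.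
  by rewrite !add1n => -[->].
have ba : b != a by rewrite eq_sym.
have ra : r = (s :\ a) :\ b by apply: rE; rewrite ?eqxx ?orbT.
have rb : r = (s :\ b) :\ a by apply: rE; rewrite ?eqxx ?orbT.
have edges x y : r = (s :\ x) :\ y -> x \in s -> y \in s -> y != x ->
    edge I s (s :\ x) && edge I (s :\ x) r.
  move=> E xs ys yx; have [s0 sG] := andP vs.
  have yx' : y \in s :\ x by rewrite !inE yx.
  have vx : isvertex I (s :\ x).
    apply/andP; split; first by apply/set0Pn; exists y.
    exact: subset_trans (subD1set _ _) sG.
  rewrite /edge vs vx vr subD1set {1 2}E subD1set /= (cardsD1 x s) xs add1n eqxx.
  by rewrite (cardsD1 y (s :\ x)) yx' add1n eqxx.
rewrite (bigD1 (s :\ a)) ?(edges a b) //= (bigD1 (s :\ b)) /=; last first.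
  rewrite (edges b a) //=; apply/eqP => E.
  by have := congr1 (fun A : vertex => a \in A) E; rewrite !inE eqxx as_ ab.
rewrite big1 => [|t /andP[/andP[/andP[/and4P[_ _ ts /eqP cst] /and4P[_ _ rt _]] ta] tb]]; last first.
  case/negP: ta; rewrite eqEcard; apply/andP; split; last first.
    by have := cardsD1 a s; rewrite as_ cst add1n => -[->].
  apply/subsetP => z zt; rewrite !inE (subsetP ts) // andbT; apply/eqP => za; subst z.
  case/negP: tb; rewrite eqEcard; apply/andP; split; last first.
    by have := cardsD1 b s; rewrite bs cst add1n => -[->].
  apply/subsetP => z zt'; rewrite !inE (subsetP ts) // andbT; apply/eqP => zb; subst z.
  have : s \subset t.
    apply/subsetP => z zs; have [zr|zr] := boolP (z \in r); first exact: (subsetP rt).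
    by have := inD z; rewrite zs zr => /esym/orP[]/eqP->.
  by move/subset_leq_card; rewrite cst ltnn.
rewrite addr0 {1}ra rb !incidence_del ?inE ?ab ?ba // (srank_del_lt as_ lt) (srank_del_gt _ lt) //.
by rewrite exprS mulN1r mulNr mulrC subrr.
Qed.

(** The value 0 keeps subsets that are not vertices out of sums over a positive dimension, so that
    [mcrit] agrees with [critical] there. *)
Definition vdim s := if isvertex I s then #|s| else 0%N.

Lemma vdim_edge s t : edge I s t -> vdim s = (vdim t).+1.
Proof. by rewrite /vdim => /and4P[-> -> _ /eqP]. Qed.

Local Notation flow := (mflow (@edge k n I d) (@matched k n I d) (@incidence k n d)).

Lemma gradient_sumE s t : gradient_sum I s t = flow s t.
Proof.
rewrite /gradient_sum /mflow /msum; apply: eq_bigr => p _.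
by elim: (val p) s => //= x w IH s; rewrite IH.
Qed.

Lemma criticalE s : critical I s = isvertex I s && mcrit (@matched k n I d) s.
Proof. by []. Qed.

Lemma gradient_sum_crit s t : critical I s -> critical I t -> #|s| = #|t| ->
  gradient_sum I s t = (s == t)%:R.
Proof.
rewrite !criticalE => /andP[vs cs] /andP[vt ct] st; rewrite gradient_sumE.
apply: (mflow_crit (e := @edge k n I d) (mt := @matched k n I d) (@incidence k n d) (medge_mrank hI hd) vdim_edge (@matched_edge _ _ _ _ hI hd)
  (@matched_alt _ _ _ _ hI hd)) => //.
by rewrite /vdim vs vt.
Qed.

Lemma medge_mono s t : medge I s t ->
  lset t \subset lset s /\ (top t == top s) || before (top t) (top s).
Proof.
case/orP=> [/andP[/and4P[vs vt ts _] _]|/(matchedP hI hd)[_ -> -> _ _]]; last first.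
  by rewrite subxx eqxx.
split; first exact: lset_sub.
have [/andP[s0 _] [topt _]] := (vs, vertex_top vt).
by apply: (topP s0).2; apply: (subsetP ts).
Qed.

Lemma gradient_sum_neq0 s t : gradient_sum I s t != 0 ->
  lset t \subset lset s /\ (top t == top s) || before (top t) (top s).
Proof.
rewrite gradient_sumE; apply: (mflow_connect (P := fun s t =>
  lset t \subset lset s /\ (top t == top s) || before (top t) (top s))) => [x|x y z].
  by rewrite subxx eqxx.
case/medge_mono=> lyx tyx [lzy tzy]; split; first exact: subset_trans lyx.
case/predU1P: tzy => [->|lt] //; case/predU1P: tyx => [<-|lt']; rewrite ?lt ?orbT //.
by have [_ tr _] := @before_strict n d; rewrite (tr _ _ _ lt lt') orbT.
Qed.

Definition cdiff s t : St := \sum_(u | edge I s u) incidence s u * gradient_sum I u t.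

Lemma cdiff_cdiff s t q : isvertex I s -> #|s| = q.+3 -> critical I t -> #|t| = q.+1 ->
  \sum_(u | critical I u && (#|u| == q.+2)) cdiff s u * cdiff u t = 0.
Proof.
rewrite criticalE => vs cs /andP[vt ct] dt.
have E (x y : vertex) : cdiff x y = mdiff (@edge k n I d) (@matched k n I d) (@incidence k n d) x y.
  by apply: eq_bigr => u _; rewrite gradient_sumE.
rewrite -[RHS](mdiff_mdiff (e := @edge k n I d) (mt := @matched k n I d)
  (inc := @incidence k n d) (medge_mrank hI hd) vdim_edge (@matched_edge _ _ _ _ hI hd)
  (@matched_funl _ _ _ _ hI hd) (@matched_funr _ _ _ _ hI hd)
  (@matched_alt _ _ _ _ hI hd) (fun t s _ => incidence_sq t s) incidence_incidence
  (s := s) (t := t) (q := q.+1)) ?/vdim ?vs ?vt ?cs ?dt //.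
apply: eq_big => [u|u _]; last by rewrite !E.
by rewrite criticalE; case: (isvertex I u); rewrite //= andbF.
Qed.
End MorseComplex.

(** * Critical sets and admissible pairs *)

Section CriticalSets.
Context {k : fieldType} {n d : nat} (I : {pred {mpoly k[n]}}) (hI : borel_fixed I).
Context (hd : forall m : 'X_{1..n}, mingen I m -> (mdeg m <= d)%N).
Local Open Scope nat_scope.
Local Notation mon := 'X_{1..n < d.+1}.
Local Notation vertex := {set mon}.
Local Notation G := (gens I d).
Local Notation pset := (@pset n d).
Local Notation pos := ('I_n * 'I_d)%type.
Implicit Types (m x y : mon) (s t r u : vertex) (i : 'I_n) (F : {set pos}) (p q : pos).

Lemma pos_eq p q : p.1 = q.1 -> p.2 = q.2 :> nat -> p = q.
Proof. by case: p q => [a b] [a' b'] /= -> /val_inj ->. Qed.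

Lemma admissibleP F m : reflect
  (m \in G /\ forall p, p \in F -> p.1.+1 < nu m /\ p.2 = partial_deg m p.1 :> nat)
  (admissible I F m).
Proof.
apply: (iffP andP) => -[mG H]; split=> //.
  by move=> p pF; have /andP[-> /eqP] := forall_inP H _ pF.
by apply/forall_inP => p /H[-> ->]; rewrite eqxx.
Qed.

Lemma admissible_sub F F' m : F' \subset F -> admissible I F m -> admissible I F' m.
Proof. by move/subsetP=> sub /admissibleP[mG H]; apply/admissibleP; split=> // p /sub/H. Qed.

Lemma admissible_inj F m p q : admissible I F m -> p \in F -> q \in F ->
  p.1 = q.1 -> p = q.
Proof.
move=> /admissibleP[_ H] /H[_ pE] /H[_ qE] pq; apply: pos_eq => //.
by rewrite pE qE pq.
Qed.

Lemma admissible_notin F m p : admissible I F m -> p \in F -> p \notin pset m.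
Proof.
move=> /admissibleP[_ H] /H[_ pE]; rewrite inE; apply/negP => /eqP cp.
have : col m p.2 <= p.1 by rewrite cp.
by rewrite -partial_deg_col pE ltnn.
Qed.

Lemma pset_bracket m p : m \in G -> p.1.+1 < nu m -> p.2 = partial_deg m p.1 :> nat ->
  p \in pset (bracket I m p.1) /\ pset (bracket I m p.1) \subset p |: pset m.
Proof.
move=> mG pm pE; have [_ _ lt cb] := bracketP hI hd mG pm.
split; first by rewrite inE pE cb // eqxx.
apply/subsetP => q qb; have := cb _ (pset_ltn qb).
move: qb; rewrite in_setU1 [in X in X -> _]inE => /eqP->; rewrite -pE.
case: eqP => [qp /val_inj q1|_ qm]; last by rewrite [in X in _ || X]inE -qm eqxx orbT.
by rewrite (pos_eq q1 qp) eqxx.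
Qed.

Lemma bracket_at m i : m \in G -> i.+1 < nu m ->
  exists p, p.1 = i /\ p.2 = partial_deg m i :> nat.
Proof.
move=> mG im; have lt : partial_deg m i < d by rewrite (leq_trans _ (mon_deg m)) // -nu_col.
by exists (i, Ordinal lt).
Qed.

Lemma notin_pset m p : p.2 = partial_deg m p.1 :> nat -> p \notin pset m.
Proof.
move=> pE; rewrite inE; apply/negP => /eqP cp.
have : col m p.2 <= p.1 by rewrite cp.
by rewrite -partial_deg_col pE ltnn.
Qed.

(** Each m_<i> contains its own new variable, and any other variable of it comes from m. *)
Lemma bracket_inj m i i' : m \in G -> i.+1 < nu m -> i'.+1 < nu m ->
  bracket I m i = bracket I m i' -> i = i'.
Proof.
move=> mG im im' bb; have [p [p1 p2]] := bracket_at mG im; have [q [q1 q2]] := bracket_at mG im'.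
subst i i'; have [pb _] := pset_bracket mG im p2; have [_ sub] := pset_bracket mG im' q2.
move: pb; rewrite bb => /(subsetP sub); rewrite in_setU1 (negbTE (notin_pset p2)) orbF.
by move/eqP->.
Qed.

(** In the column altered for i, the second word has either i' or the letter of m, both larger than
    i. *)
Lemma bracket_before2 m i i' : m \in G -> i.+1 < nu m -> i'.+1 < nu m ->
  i < i' -> before (bracket I m i) (bracket I m i').
Proof.
move=> mG im im' ii; have [_ _ lt cb] := bracketP hI hd mG im.
have [_ _ lt' cb'] := bracketP hI hd mG im'.
have le : partial_deg m i <= partial_deg m i'.
  have [//|lt2] := leqP; have: col m (partial_deg m i') <= i by rewrite -partial_deg_col.
  by move/leq_trans/(_ (ltnW ii)); rewrite -partial_deg_col ltnn.
apply/lexgtP; exists (partial_deg m i) => [|j jp]; last first.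
  rewrite cb ?(ltn_trans jp) // cb' ?(ltn_trans (leq_trans jp le)) //.
  by rewrite !ltn_eqF // (leq_trans jp).
rewrite cb // eqxx cb' ?(leq_ltn_trans le) //.
case: eqP => // _; by rewrite ltnNge -partial_deg_col ltnn.
Qed.

(** On admissible pairs, the inverse of the bijection from critical sets. *)
Definition crit_of F m : vertex := m |: [set bracket I m p.1 | p in F].

Section Admissible.
Context (F : {set pos}) (m : mon) (aFm : admissible I F m).

Let mG : m \in G. Proof. by case/admissibleP: aFm. Qed.
Let nuF p : p \in F -> p.1.+1 < nu m. Proof. by case/admissibleP: aFm => _ H /H[]. Qed.
Let pdF p : p \in F -> p.2 = partial_deg m p.1 :> nat.
Proof. by case/admissibleP: aFm => _ H /H[]. Qed.

Lemma crit_ofP x : reflect (x = m \/ exists2 p, p \in F & x = bracket I m p.1)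
  (x \in crit_of F m).
Proof.
rewrite in_setU1; apply: (iffP predU1P) => -[->|]; try by left.
  by case/imsetP=> p pF ->; right; exists p.
by case=> p pF ->; right; apply: imset_f.
Qed.

Lemma bracket_neq p : p \in F -> bracket I m p.1 != m.
Proof. by move=> pF; apply: (strict_neq before_strict (bracket_before hI hd mG (nuF pF))). Qed.

Lemma bracket_injF p q : p \in F -> q \in F -> bracket I m p.1 = bracket I m q.1 -> p = q.
Proof.
move=> pF qF /(bracket_inj mG (nuF pF) (nuF qF)); exact: admissible_inj aFm pF qF.
Qed.

Lemma top_crit_of : top (crit_of F m) = m.
Proof.
apply: top_eq; first exact: setU11.
move=> x /crit_ofP[->|[p pF ->]]; first by rewrite eqxx.
by rewrite bracket_before ?orbT ?nuF.
Qed.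

Lemma vertex_crit_of : isvertex I (crit_of F m).
Proof.
apply/andP; split; first by apply/set0Pn; exists m; apply: setU11.
apply/subsetP => x /crit_ofP[->//|[p pF ->]].
by have [] := bracketP hI hd mG (nuF pF).
Qed.

Lemma lset_crit_of : lset (crit_of F m) = pset m :|: F.
Proof.
apply/setP => q; rewrite in_setU; apply/mem_lset/orP => [[x /crit_ofP[->|[p pF ->]] qx]|].
- by left.
- have [_ /subsetP/(_ _ qx)] := pset_bracket mG (nuF pF) (pdF pF).
  by rewrite in_setU1 => /predU1P[->|]; [right|left].
case=> [qm|qF]; first by exists m; first exact: setU11.
exists (bracket I m q.1); first exact/setU1r/imset_f.
by have [] := pset_bracket mG (nuF qF) (pdF qF).
Qed.

Lemma card_crit_of : #|crit_of F m| = #|F|.+1.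
Proof.
rewrite /crit_of cardsU1 card_in_imset; last by move=> p q pF qF; apply: bracket_injF.
suff -> : m \notin [set bracket I m p.1 | p in F] by rewrite add1n.
by apply/imsetP => -[p pF /esym/eqP]; apply/negP/bracket_neq.
Qed.

Lemma Nset_crit_of x : x \in Nset I (crit_of F m) ->
  exists2 p, p \in F & x = bracket I m p.1.
Proof.
case/NsetP=> i; rewrite top_crit_of => -[im sub ->].
have [p [p1 p2]] := bracket_at mG im; subst i.
have [pb _] := pset_bracket mG im p2; exists p => //.
move: (subsetP sub _ pb); rewrite lset_crit_of in_setU => /orP[] // pm.
by case/negP: (notin_pset p2).
Qed.

(** A candidate in N_s is some m_<i>, whose new variable occurs in no other element of the set. For
    a candidate outside N_s only m can lie above it, so it divides m and equals m. *)
Lemma Dset_crit_of : Dset I (crit_of F m) = set0.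
Proof.
apply/eqP/set0Pn => -[c /DsetP[cG ctop csub]]; rewrite top_crit_of in ctop.
have sP := sbefore_strict I (crit_of F m); have [ir _ _] := sP.
have NF p : p \in F -> bracket I m p.1 \in Nset I (crit_of F m).
  move=> pF; apply/NsetP; exists p.1; rewrite top_crit_of; split=> //; first exact: nuF.
  have [_ sub] := pset_bracket mG (nuF pF) (pdF pF).
  apply: subset_trans sub _; rewrite lset_crit_of; apply/subsetP => q.
  by rewrite in_setU1 in_setU => /predU1P[->|->] //; rewrite pF orbT.
have [cN|cN] := boolP (c \in Nset I (crit_of F m)).
  have [p pF cE] := Nset_crit_of cN.
  have [pb _] := pset_bracket mG (nuF pF) (pdF pF).
  move: (subsetP csub p); rewrite cE => /(_ pb)/mem_lset[x]; rewrite inE => /andP[xs lt].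
  case/crit_ofP: xs lt => [->|[q qF ->]] lt px.
    by case/negP: (notin_pset (pdF pF)).
  have [_ sub] := pset_bracket mG (nuF qF) (pdF qF).
  move: (subsetP sub _ px); rewrite in_setU1 (negbTE (notin_pset (pdF pF))) orbF => /eqP pq.
  by move: lt; rewrite pq ir.
have sub : pset c \subset pset m.
  apply: subset_trans csub _; apply/bigcupsP => x; rewrite inE => /andP[xs lt].
  case/crit_ofP: xs lt => [->//|[q qF ->]].
  by rewrite /sbefore (negbTE cN) NF.
by move: ctop; rewrite (gens_antichain cG mG sub) ir.
Qed.

End Admissible.

(** If n_s exists, s is matched with the set obtained by toggling it. *)
Lemma criticalP s : reflect (isvertex I s /\ Dset I s = set0) (critical I s).
Proof.
apply: (iffP andP) => -[vs].
  move=> /forallP cs; split=> //; apply/eqP; apply: contraT => D0.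
  have [nin|nin] := boolP (nmin I s \in s).
    have [||vt _ _ nD nE] := @toggle_nmin _ _ _ _ hI hd s (s :\ nmin I s) vs D0.
    - exact: subxx.
    - exact: subset_trans (subD1set _ _) (subsetUr _ _).
    have Dt : Dset I (s :\ nmin I s) != set0 by apply/set0Pn; exists (nmin I s).
    move/(_ (s :\ nmin I s)): cs => /andP[/negP[]]; rewrite matchedE //.
    by rewrite vt Dt nE setD11 setD1K // eqxx.
  by move/(_ (nmin I s |: s)): cs => /andP[_ /negP[]]; rewrite matchedE // vs D0 nin eqxx.
move=> D0; split=> //; apply/forallP => t; apply/andP; split; apply/negP.
  by case/(matchedP hI hd) => _ _ _ [_ + _]; rewrite D0 eqxx.
by case/(matchedP hI hd) => _ _ _ [+ _ _]; rewrite D0 eqxx.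
Qed.

Lemma critical_crit_of F m : admissible I F m -> critical I (crit_of F m).
Proof. by move=> aFm; apply/criticalP; split; [apply: vertex_crit_of|apply: Dset_crit_of]. Qed.

Lemma admissible_Fcrit s : isvertex I s -> admissible I (Fcrit I s) (top s).
Proof.
case/vertex_top=> _ tG; apply/admissibleP; split=> // p.
by rewrite inE => /and3P[-> _ /eqP].
Qed.

(** For c in s other than the top, the first column where the two words differ yields an i such that
    m_<i> divides the lcm of c and the top. If c were not m_<i>, then m_<i> would precede both and
    lie in [Dset s]. *)
Lemma critical_eq s : critical I s -> s = crit_of (Fcrit I s) (top s).
Proof.
case/criticalP=> vs D0; have [ts tG] := vertex_top vs.
have sG x : x \in s -> x \in G by case/andP: vs => _ /subsetP; apply.
apply/setP => c; apply/idP/crit_ofP => [cs|[->//|[p]]]; last first.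
  by rewrite inE => /and3P[_ ps _ ->].
have [->|cm] := eqVneq c (top s); [by left | right].
have cbt : before c (top s).
  by case/andP: vs => /topP[_ tmax] _; case/predU1P: (tmax _ cs) cm => [->|//]; rewrite eqxx.
case/lexgtP: (cbt) => j clt ceq.
have cn : col c j < n by apply: leq_trans clt _; case: (ltnP j (mdeg (top s))) => jm;
  [apply: ltnW; rewrite col_ltn | rewrite col_default].
have jc : j < mdeg c by rewrite -col_ltn.
have jt : j < mdeg (top s).
  rewrite ltnNge; apply/negP => le; suff tc : pset (top s) \subset pset c.
    by move: cm; rewrite (gens_antichain tG (sG _ cs) tc) eqxx.
  by apply/subsetP => p pt; move: (pt); rewrite !inE ceq // (leq_trans (pset_ltn pt)).
pose i := Ordinal cn.
have it : i.+1 < nu (top s).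
  rewrite nu_col; apply: leq_ltn_trans jt; rewrite leqNgt partial_deg_col -ltnNge //.
have pdE : partial_deg (top s) i = j.
  apply/anti_leq/andP; split; first by rewrite leqNgt partial_deg_col -ltnNge.
  case: j clt ceq jc jt cn @i it => // j clt ceq jc jt cn i it.
  rewrite partial_deg_col -ceq //; exact: col_mono.
have [p [p1 p2]] := bracket_at tG it.
have pc : p \in pset c by rewrite inE p1 p2 pdE.
subst i; rewrite -p1 in it p2; have [pb sub] := pset_bracket tG it p2.
have bN : bracket I (top s) p.1 \in Nset I s.
  apply/NsetP; exists p.1; split=> //; apply: subset_trans sub _; apply/subsetP => q.
  by rewrite in_setU1 => /predU1P[->|qt]; apply/mem_lset; [exists c|exists (top s)].
have bG : bracket I (top s) p.1 \in G by have [] := bracketP hI hd tG it.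
have [cE|cne] := eqVneq c (bracket I (top s) p.1).
  by exists p => //; rewrite inE it -cE cs p2 eqxx.
exfalso; suff : bracket I (top s) p.1 \in Dset I s by rewrite D0 inE.
have sbc : sbefore I s (bracket I (top s) p.1) c.
  (* Were c also in N_s, containing the new variable p would force it to be the bracket at p. *)
  rewrite /sbefore bN; case: (boolP (c \in Nset I s)) => //= cN.
  case/NsetP: (cN) => i' [it' _ cE]; have [q [q1 q2]] := bracket_at tG it'.
  subst i'; have [_ sub'] := pset_bracket tG it' q2.
  move: pc; rewrite cE => /(subsetP sub'); rewrite in_setU1 (negbTE (notin_pset p2)) orbF => /eqP pq.
  by move: cne; rewrite cE pq eqxx.
apply/DsetP; split=> //.
  by rewrite (sbefore_top hI hd) //; apply: bracket_before.
apply: subset_trans sub _; apply/subsetP => q; rewrite in_setU1 => /predU1P[->|qt].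
  by apply/mem_lset; exists c; rewrite // inE cs.
apply/mem_lset; exists (top s); rewrite // inE ts (sbefore_top hI hd) //.
exact: bracket_before.
Qed.

Lemma Fcrit_crit_of F m : admissible I F m -> Fcrit I (crit_of F m) = F.
Proof.
move=> aFm; apply/setP => p; rewrite inE (top_crit_of aFm).
have [mG H] := admissibleP _ _ aFm.
apply/and3P/idP => [[pm /crit_ofP]|pF]; last first.
  by have [-> ->] := H _ pF; rewrite eqxx; split=> //; apply/setU1r/imset_f.
case=> [bm|[q qF]]; last first.
  have [qm qE] := H _ qF; move/(bracket_inj mG pm qm) => pq /eqP pE.
  by suff -> : p = q; [|apply: pos_eq; rewrite // pE qE pq].
by have := strict_neq before_strict (bracket_before hI hd mG pm); rewrite bm eqxx.
Qed.

Lemma crit_of_rigid F m F' m' : admissible I F m -> admissible I F' m' ->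
  #|F| = #|F'|.+1 -> pset m' :|: F' \subset pset m :|: F -> m' != m ->
  exists2 p, p \in F & F' = F :\ p /\ m' = bracket I m p.1.
Proof.
move=> aFm aFm' cF /subsetP sub mm'.
have [mG H] := admissibleP _ _ aFm; have [mG' H'] := admissibleP _ _ aFm'.
(* A column where the words differ is filled from F, and then lies to the left
   of the letter of m; so no new variable of m' can be a variable of m. *)
have diff j : j < mdeg m' -> col m' j != col m j ->
    exists2 p, p \in F & [/\ p \in pset m', p.2 = j :> nat & col m' j < col m j].
  move=> jm' ne; have [p [pm' p1 p2]] := pset_at jm' (mon_deg m').
  have pF : p \in F.
    move: (sub p); rewrite !in_setU pm' => /(_ isT)/orP[|//].
    by rewrite inE p1 p2 eq_sym (negbTE ne).
  exists p => //; split=> //; have [_ pE] := H _ pF.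
  by rewrite -p1 ltnNge -partial_deg_col -pE p2 ltnn.
have F'F f : f \in F' -> f \in F.
  move=> fF'; have [fm' fE] := H' _ fF'.
  move: (sub f); rewrite !in_setU fF' orbT => /(_ isT)/orP[|//] fm.
  have lt : f.1 < col m' f.2 by rewrite ltnNge -partial_deg_col -fE ltnn.
  have jm' : f.2 < mdeg m' by rewrite fE -nu_col.
  move: (fm); rewrite inE => /eqP cf.
  have ne : col m' f.2 != col m f.2 by rewrite cf gtn_eqF.
  by have [_ _ [_ _]] := diff _ jm' ne; rewrite cf ltnNge (ltnW lt).
have [j jm' ne] : exists2 j, j < mdeg m' & col m' j != col m j.
  case: (pickP (fun j : 'I_(mdeg m') => col m' j != col m j)) => [j ne|no]; first by exists j.
  case/negP: mm'; apply/eqP/(gens_antichain mG' mG)/subsetP => p pm'.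
  move: (pm'); rewrite !inE => /eqP<-; rewrite eq_sym.
  by have /negbFE := no (Ordinal (pset_ltn pm')).
have [p pF [pm' p2 lt]] := diff _ jm' ne; have [pm pE] := H _ pF.
(* F' avoids the variables of m', so it misses p, and by cardinality nothing else. *)
have F'E : F' = F :\ p.
  apply/eqP; rewrite eqEcard; apply/andP; split; last first.
    by have := cardsD1 p F; rewrite pF cF add1n => -[->].
  apply/subsetP => f fF'; rewrite !inE F'F // andbT; apply: contraTneq pm' => <-.
  exact: admissible_notin aFm' fF'.
exists p => //; split=> //; apply: (bracket_uniq hI hd) => // j' jm'2.
have [->|jj] := eqVneq j' (partial_deg m p.1).
  by move: pm'; rewrite inE pE => /eqP.
(* Another differing column would be filled from a p' in F', which cannot be a variable of m'. *)
apply/eqP; apply: contraT => /(diff _ jm'2)[p' p'F [p'm' p'2 _]].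
have : p' \in F'.
  rewrite F'E !inE p'F andbT; apply: contraNneq jj => pp'.
  by rewrite -p'2 pp' pE.
by move/(admissible_notin aFm'); rewrite p'm'.
Qed.
End CriticalSets.

(** * The coefficients of the Morse differential *)

Section Coefficients.
Context {k : fieldType} {n d : nat} (I : {pred {mpoly k[n]}}) (hI : borel_fixed I).
Context (hd : forall m : 'X_{1..n}, mingen I m -> (mdeg m <= d)%N).
Local Notation mon := 'X_{1..n < d.+1}.
Local Notation vertex := {set mon}.
Local Notation G := (gens I d).
Local Notation pset := (@pset n d).
Local Notation pos := ('I_n * 'I_d)%type.
Local Notation St := {mpoly k[n * d]}.
Implicit Types (m x y : mon) (s t r u : vertex) (i : 'I_n) (F : {set pos}) (p q : pos).

Lemma crit_of_eq F m F' m' : admissible I F m -> admissible I F' m' ->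
  (crit_of I F m == crit_of I F' m') = (F == F') && (m == m').
Proof.
move=> aF aF'; apply/eqP/andP => [E|[/eqP-> /eqP-> //]].
have mm : m = m' by rewrite -(top_crit_of hI hd aF) E (top_crit_of hI hd aF').
split; last by rewrite mm.
by rewrite -(Fcrit_crit_of hI hd aF) E (Fcrit_crit_of hI hd aF').
Qed.

Section Admissible.
Context (F : {set pos}) (m : mon) (aFm : admissible I F m).

Let mG : m \in G. Proof. by case/admissibleP: aFm. Qed.
Let nuF p : p \in F -> (p.1.+1 < nu m)%N. Proof. by case/admissibleP: aFm => _ H /H[]. Qed.

Lemma before_bracketF p q : p \in F -> q \in F ->
  (bracket I m p.1 == bracket I m q.1) || before (bracket I m p.1) (bracket I m q.1) =
  (p.1 <= q.1)%N.
Proof.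
move=> pF qF; have b2 := bracket_before2 hI hd mG.
have [lt|lt|E] := ltngtP p.1 q.1.
- by rewrite (b2 _ _ (nuF pF) (nuF qF) lt) orbT.
- have b := b2 _ _ (nuF qF) (nuF pF) lt.
  rewrite (strict_asym before_strict b) orbF eq_sym.
  exact: negbTE (strict_neq before_strict b).
- by rewrite (val_inj E) eqxx.
Qed.

(** Since m_<i> increases with i, the incidence sign of the face without m_<i_r> is (-1)^r. *)
Lemma srank_bracket p : p \in F -> srank (crit_of I F m) (bracket I m p.1) = frank F p.
Proof.
move=> pF; rewrite /srank /frank -[RHS](card_in_imset (f := fun q : pos => bracket I m q.1)).
  apply: eq_card => x; rewrite [LHS]inE; apply/andP/imsetP => [[/crit_ofP[->|[q qF ->]]]|].
  - have bm := bracket_before hI hd mG (nuF pF).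
    rewrite (strict_asym before_strict bm) orbF eq_sym => /eqP bE.
    by have := strict_neq before_strict bm; rewrite bE eqxx.
  - by rewrite before_bracketF // => le; exists q; rewrite // inE qF.
  - case=> q; rewrite inE => /andP[qF le] ->; split; last by rewrite before_bracketF.
    by apply/crit_ofP; right; exists q.
move=> a b; rewrite !inE => /andP[aF _] /andP[bF _].
by move/(bracket_injF hI hd aFm aF bF).
Qed.

Lemma srank_top : srank (crit_of I F m) m = #|F|.+1.
Proof.
rewrite /srank -(card_crit_of hI hd aFm); apply: eq_card => x; rewrite inE.
case: (boolP (x \in _)) => //= /crit_ofP[->|[p pF ->]]; first by rewrite eqxx.
by rewrite (bracket_before hI hd mG (nuF pF)) orbT.
Qed.

Lemma crit_of_del p : p \in F ->
  crit_of I F m :\ bracket I m p.1 = crit_of I (F :\ p) m.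
Proof.
move=> pF; apply/setP => x; rewrite in_setD1; apply/andP/crit_ofP.
  case=> xp /crit_ofP[->|[q qF xq]]; [by left | right; exists q => //].
  by rewrite !inE qF andbT; apply: contraNneq xp => <-; rewrite xq.
case=> [->|[q + ->]].
  by split; [rewrite eq_sym (bracket_neq hI hd aFm pF) | apply: setU11].
rewrite in_setD1 => /andP[qp qF]; split; last by apply/crit_ofP; right; exists q.
by apply: contraNneq qp => /(bracket_injF hI hd aFm qF pF) ->.
Qed.

Lemma adm_del p : admissible I (F :\ p) m.
Proof. exact: admissible_sub (subD1set _ _) aFm. Qed.

Lemma edge_crit_of u : (0 < #|F|)%N -> edge I (crit_of I F m) u =
  (u == crit_of I F m :\ m) || [exists p in F, u == crit_of I (F :\ p) m].
Proof.
move=> F0; have cc := card_crit_of hI hd aFm; apply/and4P/orP.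
  case=> _ _ us /eqP cu.
  have [x xs xu] : exists2 x, x \in crit_of I F m & x \notin u.
    by apply/subsetPn; apply/negP => /subset_leq_card; rewrite cu ltnn.
  have uE : u = crit_of I F m :\ x.
    apply/eqP; rewrite eqEcard subsetD1 us xu /=.
    by have := cardsD1 x (crit_of I F m); rewrite xs cu add1n => -[->].
  case/crit_ofP: xs uE => [->|[p pF ->]] ->; [by left; rewrite eqxx|right].
  by apply/exists_inP; exists p; rewrite ?crit_of_del.
have H x : x \in crit_of I F m -> [/\ isvertex I (crit_of I F m),
    isvertex I (crit_of I F m :\ x), crit_of I F m :\ x \subset crit_of I F m &
    #|crit_of I F m| == #|crit_of I F m :\ x|.+1].
  move=> xs; have vs := vertex_crit_of hI hd aFm; rewrite subD1set; split=> //.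
    apply/andP; split; last by apply: subset_trans (subD1set _ _) _; case/andP: vs.
    by rewrite -card_gt0; have := cardsD1 x (crit_of I F m); rewrite xs cc add1n => -[<-].
  by rewrite (cardsD1 x (crit_of I F m)) xs add1n.
case=> [/eqP->|/exists_inP[p pF /eqP->]]; first by apply: H; apply: setU11.
by rewrite -crit_of_del //; apply: H; apply/crit_ofP; right; exists p.
Qed.

(** The faces that keep m are critical, so their flow is trivial; what is left is the path sum from
    the face without m. *)
Lemma cdiffE t : (0 < #|F|)%N -> critical I t -> #|t| = #|F| ->
  cdiff I (crit_of I F m) t =
    (\sum_(p in F) (-1) ^+ frank F p * (crit_of I (F :\ p) m == t)%:R) +
    (-1) ^+ #|F|.+1 * gradient_sum I (crit_of I F m :\ m) t :> St.
Proof.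
move=> F0 ct cF; rewrite /cdiff (bigD1 (crit_of I F m :\ m)) /=; last first.
  by rewrite edge_crit_of // eqxx.
rewrite addrC incidence_del ?setU11 // srank_top; congr (_ + _).
have inj : {in F &, injective (fun p => crit_of I (F :\ p) m)}.
  move=> p q pF qF /eqP; rewrite crit_of_eq ?adm_del // eqxx andbT => /eqP FF.
  have : p \notin F :\ q by rewrite -FF setD11.
  by rewrite !inE pF andbT negbK => /eqP.
transitivity (\sum_(u in [set crit_of I (F :\ p) m | p in F])
    incidence (crit_of I F m) u * gradient_sum I u t : St).
  apply: eq_bigl => u; rewrite edge_crit_of //; apply/andP/imsetP.
    by case=> /orP[->//|/exists_inP[p pF /eqP->]] _; exists p.
  case=> p pF ->; split; first by apply/orP; right; apply/exists_inP; exists p.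
  apply/eqP => E; have : m \in crit_of I (F :\ p) m by apply: setU11.
  by rewrite E setD11.
rewrite big_imset //=; apply: eq_bigr => p pF.
rewrite -{1}crit_of_del // incidence_del; last by apply/crit_ofP; right; exists p.
rewrite srank_bracket // gradient_sum_crit //; first exact: critical_crit_of (adm_del p).
rewrite (card_crit_of hI hd (adm_del p)) cF (cardsD1 p F) pF //.
Qed.

(** Once m is deleted, the tops stay strictly before it; hence m' differs from m and rigidity
    applies. *)
Lemma gradient_sum_top F' m' : admissible I F' m' -> #|F| = #|F'|.+1 ->
  gradient_sum I (crit_of I F m :\ m) (crit_of I F' m') != 0 ->
  exists2 p, p \in F & F' = F :\ p /\ m' = bracket I m p.1.
Proof.
move=> aF' cF /(gradient_sum_neq0 hI hd)[lsub].
rewrite (top_crit_of hI hd aF') => tm.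
apply: (crit_of_rigid hI hd aFm aF' cF).
  rewrite -(lset_crit_of hI hd aF') -(lset_crit_of hI hd aFm).
  exact: subset_trans lsub (lset_sub (subD1set _ _)).
have s0 : crit_of I F m :\ m != set0.
  have := cardsD1 m (crit_of I F m); rewrite setU11 (card_crit_of hI hd aFm) cF add1n.
  by case=> E; rewrite -card_gt0 -E.
have [+ _] := topP s0; rewrite in_setD1 => /andP[tne /crit_ofP[tE|[p pF tE]]].
  by rewrite tE eqxx in tne.
have tb : before (top (crit_of I F m :\ m)) m.
  by rewrite tE; apply: bracket_before => //; apply: nuF.
case/predU1P: tm => [->//|lt].
have [_ tr _] := @before_strict n d.
exact: (strict_neq before_strict (tr _ _ _ lt tb)).
Qed.

Lemma cdiff_del p : p \in F ->
  cdiff I (crit_of I F m) (crit_of I (F :\ p) m) = (-1) ^+ frank F p :> St.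
Proof.
move=> pF; have F0 : (0 < #|F|)%N by apply/card_gt0P; exists p.
have cFp : #|F| = #|F :\ p|.+1 by rewrite (cardsD1 p F) pF.
rewrite cdiffE //; [| exact: critical_crit_of (adm_del p)
  | by rewrite (card_crit_of hI hd (adm_del p)) cFp].
have -> : gradient_sum I (crit_of I F m :\ m) (crit_of I (F :\ p) m) = 0.
  apply/eqP; apply: contraT => /(gradient_sum_top (adm_del p) cFp)[q qF [_ mE]].
  by have := bracket_neq hI hd aFm qF; rewrite -mE eqxx.
rewrite mulr0 addr0 (bigD1 p) //= eqxx mulr1 big1 ?addr0 // => q /andP[qF qp].
rewrite crit_of_eq ?adm_del // eqxx andbT.
case: eqP => [FF|_]; last by rewrite mulr0.
have : q \notin F :\ p by rewrite -FF setD11.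
by rewrite !inE qF andbT negbK (negbTE qp).
Qed.

Lemma cdiff_neq0 t : (0 < #|F|)%N -> critical I t -> #|t| = #|F| ->
  cdiff I (crit_of I F m) t != 0 :> St ->
  exists2 p, p \in F & t = crit_of I (F :\ p) m \/
    admissible I (F :\ p) (bracket I m p.1) /\ t = crit_of I (F :\ p) (bracket I m p.1).
Proof.
move=> F0 ct cF nz.
have [/exists_inP[p pF /eqP tE]|no] := boolP [exists p in F, crit_of I (F :\ p) m == t].
  by exists p => //; left.
move: nz; rewrite cdiffE // big1 ?add0r => [|p pF]; last first.
  have -> : (crit_of I (F :\ p) m == t) = false; last by rewrite mulr0.
  by apply: contraNF no => E; apply/exists_inP; exists p.
have vt : isvertex I t by case/andP: ct.
have at_ := admissible_Fcrit vt; have tE := critical_eq hI hd ct.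
have cFt : #|F| = #|Fcrit I t|.+1 by rewrite -cF {1}tE (card_crit_of hI hd at_).
move=> nz; have : gradient_sum I (crit_of I F m :\ m) t != 0.
  by apply: contraNneq nz => ->; rewrite mulr0.
rewrite {1}tE => /(gradient_sum_top at_ cFt)[p pF [FE mE]].
by exists p => //; right; rewrite -FE -mE.
Qed.
End Admissible.
End Coefficients.

(** * Coefficients at the bracketed generators *)

Section BracketCoefficients.
Context {k : fieldType} {n d : nat} (I : {pred {mpoly k[n]}}) (hI : borel_fixed I).
Context (hd : forall m : 'X_{1..n}, mingen I m -> (mdeg m <= d)%N).
Local Notation mon := 'X_{1..n < d.+1}.
Local Notation vertex := {set mon}.
Local Notation G := (gens I d).
Local Notation pset := (@pset n d).
Local Notation pos := ('I_n * 'I_d)%type.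
Local Notation St := {mpoly k[n * d]}.
Implicit Types (m x y : mon) (s t r u : vertex) (i : 'I_n) (F : {set pos}) (p q : pos).

Lemma frank_del_lt F p q : q \in F -> (q.1 <= p.1)%N ->
  frank F p = (frank (F :\ q) p).+1.
Proof.
move=> qF qp; rewrite /frank (cardsD1 q) !inE qF qp add1n; congr _.+1.
by apply: eq_card => z; rewrite !inE andbA.
Qed.

Lemma frank_del_gt F p q : (p.1 < q.1)%N -> frank (F :\ q) p = frank F p.
Proof.
move=> pq; apply: eq_card => z; rewrite !inE; case: eqP => //= ->.
by rewrite leqNgt pq andbF.
Qed.

Lemma frank_sign F m p q : admissible I F m -> p \in F -> q \in F -> p != q ->
  (-1) ^+ frank F q * (-1) ^+ frank (F :\ q) p =
  - ((-1) ^+ frank F p * (-1) ^+ frank (F :\ p) q) :> St.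
Proof.
move=> aFm pF qF pq; have [lt|lt|E] := ltngtP p.1 q.1.
- by rewrite (frank_del_lt pF (ltnW lt)) (frank_del_gt _ lt) exprS mulN1r mulNr mulrC.
- by rewrite [in RHS](frank_del_lt qF (ltnW lt)) (frank_del_gt _ lt) exprS mulN1r mulNr opprK mulrC.
- by rewrite (admissible_inj aFm pF qF (val_inj E)) eqxx in pq.
Qed.

(** Rules out a route to (F \ {p, q}, m_<p>) through m_<q>. Equality would put p and q in the same
    column, and the two admissibilities would give both q.1 < p.1 and p.1 < q.1. *)
Lemma bracket_bracket_neq F m p q : admissible I F m -> p \in F -> q \in F -> p != q ->
  admissible I (F :\ p) (bracket I m p.1) -> admissible I (F :\ q) (bracket I m q.1) ->
  bracket I m p.1 <> bracket I (bracket I m q.1) p.1.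
Proof.
move=> aFm pF qF pq ap aq; have [mG H] := admissibleP _ _ _ aFm.
have [cG Hc] := admissibleP _ _ _ ap; have [bG Hb] := admissibleP _ _ _ aq.
have qp : q \in F :\ p by rewrite !inE eq_sym pq.
have pq' : p \in F :\ q by rewrite !inE pq.
have [qnu qE] := Hc _ qp; have [pnu pE] := Hb _ pq'.
have [qm qmE] := H _ qF; have [+ _] := pset_bracket hI hd mG qm qmE.
rewrite inE => /eqP bq E.
have cq : (q.1 < col (bracket I m p.1) q.2)%N by rewrite ltnNge -partial_deg_col -qE ltnn.
have bp : (p.1 < col (bracket I m q.1) p.2)%N by rewrite ltnNge -partial_deg_col -pE ltnn.
have lq : (q.2 < mdeg (bracket I m p.1))%N by rewrite qE -nu_col.
have [_ _ _ cb] := bracketP hI hd bG pnu.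
move: (cb q.2); rewrite -E -pE => /(_ lq); case: eqP => [qp2 cE|_ cE]; last first.
  by rewrite cE bq ltnn in cq.
by move: cq bp; rewrite cE -qp2 bq => lt /(ltn_trans lt); rewrite ltnn.
Qed.

(* The coefficient is read off from the vanishing of the square of the Morse
   differential: deleting q before or after passing from m to m_<p> are the only
   two ways to go from (F, m) to (F \ {p, q}, m_<p>). *)
Lemma cdiff_bracket F m p : admissible I F m -> p \in F ->
  admissible I (F :\ p) (bracket I m p.1) ->
  cdiff I (crit_of I F m) (crit_of I (F :\ p) (bracket I m p.1)) =
  - (-1) ^+ frank F p :> St.
Proof.
have [N] := ubnP #|F|; elim: N F p => // N IH F p /ltnSE leF aFm pF ap.
have [mG H] := admissibleP _ _ _ aFm.
have cFp : #|F| = #|F :\ p|.+1 by rewrite (cardsD1 p F) pF.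
have F0 : (0 < #|F|)%N by rewrite cFp.
have bm : bracket I m p.1 != m := bracket_neq hI hd aFm pF.
have [E0|[q qFp]] := set_0Vmem (F :\ p).
  have FE : F = [set p] by rewrite -(setD1K pF) E0 setU0.
  have ap' := ap; rewrite E0 in ap' *.
  have a0 : admissible I set0 m by apply: admissible_sub aFm; apply: sub0set.
  rewrite (cdiffE hI hd aFm F0); [| exact: critical_crit_of hI hd _ _ ap'
    | by rewrite (card_crit_of hI hd ap') cards0 FE cards1].
  rewrite FE big_set1 setDv (crit_of_eq hI hd a0 ap') eqxx eq_sym (negbTE bm) mulr0 add0r.
  have -> : crit_of I [set p] m :\ m = crit_of I set0 (bracket I m p.1).
    apply/setP => x; rewrite in_setD1; apply/andP/crit_ofP.
      case=> xm /crit_ofP[xE|[q]]; first by rewrite xE eqxx in xm.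
      by rewrite inE => /eqP-> ->; left.
    case=> [->|[q]]; last by rewrite inE.
    by split=> //; apply/crit_ofP; right; exists p; rewrite ?inE.
  have cr := critical_crit_of hI hd ap'.
  rewrite (gradient_sum_crit hI hd cr cr) // eqxx mulr1 cards1.
  rewrite /frank (_ : #|_| = 1%N) ?expr2 ?mulrNN ?mulr1 ?expr1 ?opprK //.
  by rewrite -[RHS](cards1 p); apply: eq_card => x; rewrite !inE; case: eqP => [->|] //=; rewrite leqnn.
have /andP[qp qF] : (q != p) && (q \in F) by move: qFp; rewrite !inE.
have pq : p != q by rewrite eq_sym.
have aq : admissible I (F :\ q) m := adm_del aFm q.
have pFq : p \in F :\ q by rewrite !inE pq.
have DD : F :\ q :\ p = F :\ p :\ q by apply/setP => x; rewrite !inE andbCA.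
have apq : admissible I (F :\ p :\ q) (bracket I m p.1) := adm_del ap q.
have apq' : admissible I (F :\ q :\ p) (bracket I m p.1) by rewrite DD.
have cFq : #|F| = #|F :\ q|.+1 by rewrite (cardsD1 q F) qF.
have cFpq : #|F :\ p| = #|F :\ p :\ q|.+1 by rewrite (cardsD1 q (F :\ p)) qFp.
have cFqp : #|F :\ q| = #|F :\ p|.
  by apply/eqP; rewrite -eqSS -cFq -cFp.
set v := crit_of I (F :\ p :\ q) (bracket I m p.1).
set u1 := crit_of I (F :\ q) m; set u2 := crit_of I (F :\ p) (bracket I m p.1).
have cv : critical I v := critical_crit_of hI hd apq.
have cardv : #|v| = #|F :\ p| by rewrite (card_crit_of hI hd apq) cFpq.
have c1 : critical I u1 := critical_crit_of hI hd aq.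
have c2 : critical I u2 := critical_crit_of hI hd ap.
have k1 : #|u1| = #|F| by rewrite (card_crit_of hI hd aq) cFq.
have k2 : #|u2| = #|F| by rewrite (card_crit_of hI hd ap) cFp.
have u12 : u2 != u1 by rewrite (crit_of_eq hI hd ap aq) (negbTE bm) andbF.
have := cdiff_cdiff hI hd (s := crit_of I F m) (t := v) (q := #|F :\ p :\ q|).
move/(_ (vertex_crit_of hI hd aFm)); rewrite (card_crit_of hI hd aFm) cardv -cFpq -cFp.
move/(_ erefl cv erefl).
rewrite (bigD1 u1) ?c1 ?k1 ?eqxx //= (bigD1 u2) ?c2 ?k2 ?eqxx ?u12 //=.
(* An intermediate u deletes some t. If it keeps m, the second step passes to m_<p>, which forces t
   = q. If it passes to m_<t>, the second step either keeps m_<t>, so t = p, or applies the bracket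
   at p, which [bracket_bracket_neq] excludes. *)
rewrite big1 ?addr0 => [|u /andP[/andP[/andP[cu /eqP ku] n1] n2]]; last first.
  apply/eqP; apply: contraT; rewrite mulf_eq0 negb_or => /andP[z1 z2].
  have [t tF [uE|[at_ uE]]] := cdiff_neq0 hI hd aFm F0 cu ku z1.
    have at' := adm_del aFm t; rewrite {}uE in z2 n1 n2.
    have cFt : #|F :\ t| = #|F :\ p| by apply/eqP; rewrite -eqSS -cFp (cardsD1 t F) tF.
    have [||t' t'F [vE|[at2 vE]]] := cdiff_neq0 hI hd at' _ cv _ z2.
    - by rewrite cFt cFpq.
    - by rewrite cardv.
    - move/eqP: vE; rewrite (crit_of_eq hI hd apq (adm_del at' t')) (negbTE bm).
      by rewrite andbF.
    move/eqP: vE; rewrite (crit_of_eq hI hd apq at2) => /andP[/eqP DE /eqP bE].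
    have t'F2 : t' \in F by move: t'F; rewrite in_setD1 => /andP[].
    have pt := bracket_injF hI hd aFm pF t'F2 bE; subst t'.
    have : t \notin F :\ p :\ q by rewrite DE !inE eqxx andbF.
    rewrite !inE tF andbT negb_and !negbK => /orP[/eqP tq|/eqP tp].
      by rewrite tq eqxx in n1.
    by rewrite tp !inE eqxx in t'F.
  rewrite {}uE in z2 n1 n2.
  have tp : t != p by apply: contraNneq n2 => ->.
  have cFt : #|F :\ t| = #|F :\ p| by apply/eqP; rewrite -eqSS -cFp (cardsD1 t F) tF.
  have [||t' t'F [vE|[at2 vE]]] := cdiff_neq0 hI hd at_ _ cv _ z2.
  - by rewrite cFt cFpq.
  - by rewrite cardv.
  - move/eqP: vE; rewrite (crit_of_eq hI hd apq (adm_del at_ t')) => /andP[_ /eqP bE].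
    by rewrite (bracket_injF hI hd aFm pF tF bE) eqxx in tp.
  move/eqP: vE; rewrite (crit_of_eq hI hd apq at2) => /andP[/eqP DE /eqP bE].
  have : p \notin F :\ t :\ t' by rewrite -DE !inE eqxx andbF.
  rewrite !inE pF andbT negb_and !negbK (eq_sym p t) (negbTE tp) orbF => /eqP pt'.
  subst t'; exfalso; rewrite eq_sym in tp.
  exact: bracket_bracket_neq aFm pF tF tp ap at_ bE.
rewrite (cdiff_del hI hd aFm qF) /v -DD (IH _ _ _ aq pFq apq'); last first.
  by apply: leq_trans leF; rewrite [leqRHS]cFq.
rewrite DD (cdiff_del hI hd ap qFp) mulrN (frank_sign aFm pF qF pq) opprK -mulrDl.
(* The common sign is cancelled by multiplying with it, its square being 1. *)
move/(congr1 (fun z : St => z * (-1) ^+ frank (F :\ p) q)); rewrite mul0r -mulrA -exprD.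
rewrite addnn -mul2n exprM sqrrN !expr1n mulr1 => /eqP; rewrite addrC addr_eq0 => /eqP.
by [].
Qed.
End BracketCoefficients.

(** * The isomorphism *)

Lemma sum_sig (V : nmodType) (T : finType) (P : pred T) (F : T -> V) :
  \sum_(x | P x) F x = \sum_(x : {x | P x}) F (val x).
Proof.
rewrite (reindex_omap (val : {x | P x} -> T) insub) => [|x Px]; last first.
  by rewrite insubT.
by apply: eq_bigl => x; rewrite valK eqxx (valP x).
Qed.

Lemma linextE {R : comNzRingType} {T T' : finType} (f : T -> {ffun T' -> R^o})
    (u : {ffun T -> R^o}) y : linext f u y = \sum_t (u t : R) * f t y.
Proof. by rewrite /linext sum_ffunE; apply: eq_bigr => t _; rewrite !ffunE. Qed.

Lemma basisvE {R : nzRingType} {T : finType} {P : pred T} (x : T) (y : {y | P y}) :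
  basisv x y = (val y == x)%:R :> R.
Proof. by rewrite ffunE. Qed.

Lemma ffun_subE {R : nzRingType} {T : finType} (f g : {ffun T -> R^o}) y :
  (f - g) y = (f y : R) - g y.
Proof. by rewrite !ffunE. Qed.

Lemma ffun_scaleE {R : nzRingType} {T : finType} (a : R) (f : {ffun T -> R^o}) y :
  (a *: f) y = a * f y.
Proof. by rewrite ffunE. Qed.

Section SqfreeQuotients.
Context {n d : nat}.
Implicit Types (A B : {set 'I_n * 'I_d}).

Lemma sqfreeU A B : [disjoint A & B] -> sqfree (A :|: B) = (sqfree A + sqfree B)%MM.
Proof. by move=> AB; rewrite /sqfree -bigU //; apply: eq_bigl => p; rewrite !inE. Qed.

Lemma sqfree_del A p : p \in A -> sqfree A = (pvar p + sqfree (A :\ p))%MM.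
Proof. by move=> pA; rewrite /sqfree (big_setD1 p). Qed.
End SqfreeQuotients.

Section Isomorphism.
Context {k : fieldType} {n d : nat} (I : {pred {mpoly k[n]}}) (hI : borel_fixed I).
Context (hd : forall m : 'X_{1..n}, mingen I m -> (mdeg m <= d)%N).
Local Notation mon := 'X_{1..n < d.+1}.
Local Notation vertex := {set mon}.
Local Notation G := (gens I d).
Local Notation pset := (@pset n d).
Local Notation pos := ('I_n * 'I_d)%type.
Local Notation St := {mpoly k[n * d]}.
Implicit Types (m x y : mon) (s t r u : vertex) (i : 'I_n) (F : {set pos}) (p : pos) (q : nat).

(** F avoids the variables of m, so the lcm is a product; its quotients are then the monomials in
    the differential of P. *)
Lemma lcm_crit_of F m : admissible I F m ->
  lcmset (crit_of I F m) = (bpol d m + sqfree F)%MM.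
Proof.
move=> aFm; rewrite lcmsetE (lset_crit_of hI hd aFm) sqfreeU ?bpolE //.
rewrite -setI_eq0; apply/eqP/setP => p; rewrite in_setI in_set0 andbC.
by case: (boolP (p \in F)) => //= pF; apply/negbTE/(admissible_notin aFm pF).
Qed.

Lemma lcm_sub_del F m p : admissible I F m -> p \in F ->
  (lcmset (crit_of I F m) - lcmset (crit_of I (F :\ p) m))%MM = pvar p.
Proof.
move=> aFm pF; rewrite (lcm_crit_of aFm) (lcm_crit_of (adm_del aFm p)).
by rewrite (sqfree_del pF); apply/mnmP => j; rewrite !(mnmDE, mnmBE) addnCA addnK.
Qed.

Lemma lcm_sub_bracket F m p : admissible I F m -> p \in F ->
  admissible I (F :\ p) (bracket I m p.1) ->
  (lcmset (crit_of I F m) - lcmset (crit_of I (F :\ p) (bracket I m p.1)))%MM =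
  (pvar p + bpol d m - bpol d (bracket I m p.1))%MM.
Proof.
move=> aFm pF ap; rewrite (lcm_crit_of aFm) (lcm_crit_of ap) (sqfree_del pF).
by apply/mnmP => j; rewrite !(mnmDE, mnmBE) addnCA addnA subnDr.
Qed.

(** Guarantees that the difference of exponents accompanying a nonzero coefficient is not
    truncated. *)
Lemma cdiff_lset s t : cdiff I s t != 0 :> St -> lset t \subset lset s.
Proof.
apply: contraR => ns; apply/eqP/big1 => u /and4P[_ _ us _].
have -> : gradient_sum I u t = 0; last by rewrite mulr0.
apply/eqP; apply: contraR ns => /(gradient_sum_neq0 hI hd)[tu _].
exact: subset_trans tu (lset_sub us).
Qed.

Lemma Qidx_crit_of q F m : Pidx I q (F, m) -> Qidx I q (crit_of I F m).
Proof.
case/andP=> /= aFm /eqP cF; rewrite /Qidx (critical_crit_of hI hd aFm).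
by rewrite (card_crit_of hI hd aFm) cF eqxx.
Qed.

Lemma Pidx_Fcrit q s : Qidx I q s -> Pidx I q (Fcrit I s, top s).
Proof.
case/andP=> cs /eqP card_s; have vs : isvertex I s by case/andP: cs.
have as_ := admissible_Fcrit vs; rewrite /Pidx /= as_ /=.
by move: card_s; rewrite {1}(critical_eq hI hd cs) (card_crit_of hI hd as_) => -[->].
Qed.

Definition crit_idx q (y : {y | Pidx I (d := d) q y}) : {s | Qidx I (d := d) q s} :=
  exist _ (crit_of I (val y).1 (val y).2)
    (Qidx_crit_of (etrans (congr1 (Pidx I q) (esym (surjective_pairing (val y)))) (valP y))).

Definition adm_idx q (s : {s | Qidx I (d := d) q s}) : {y | Pidx I (d := d) q y} :=
  exist _ (Fcrit I (val s), top (val s)) (Pidx_Fcrit (valP s)).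

Lemma crit_idxK q : cancel (@crit_idx q) (@adm_idx q).
Proof.
move=> [[F m] yP]; apply: val_inj => /=; have /andP[/= aFm _] := yP.
by rewrite (Fcrit_crit_of hI hd aFm) (top_crit_of hI hd aFm).
Qed.

Lemma adm_idxK q : cancel (@adm_idx q) (@crit_idx q).
Proof.
move=> [s sP]; apply: val_inj => /=; have /andP[cs _] := sP.
by rewrite -(critical_eq hI hd cs).
Qed.

Lemma QtoPE q (u : Qmod I d q) (y : {y | Pidx I q y}) :
  (QtoP I d q u : {ffun _ -> _}) y = u (crit_idx y).
Proof.
have E (s : {s | Qidx I q s}) : (val y == (Fcrit I (val s), top (val s))) = (s == crit_idx y).
  rewrite -[(_, _)]/(val (adm_idx s)) (inj_eq val_inj) eq_sym.
  by rewrite (can2_eq (@adm_idxK q) (@crit_idxK q)).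
transitivity (\sum_(s : {s | Qidx I q s}) (u s : St) * (s == crit_idx y)%:R).
  rewrite /QtoP linextE; apply: eq_bigr => s _; congr (_ * _).
  by rewrite basisvE E.
rewrite (bigD1 (crit_idx y)); last by [].
rewrite eqxx mulr1 big1; first exact: addr0.
by move=> s /negbTE sy; rewrite sy mulr0.
Qed.

Lemma QtoP_bij q : bijective (QtoP I d q).
Proof.
exists (fun v : Pmod I d q.+1 => [ffun s => (v : {ffun _ -> _}) (adm_idx s)] : Qmod I d q).
  by move=> u; apply/ffunP => s; rewrite ffunE QtoPE adm_idxK.
by move=> v; apply/ffunP => y; rewrite QtoPE ffunE crit_idxK.
Qed.

(** Both parts of the differential merge into one Morse coefficient, because lcm(s)/lcm(t) is the
    variable x_{i_r,j_r} on a face that keeps the top. *)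
Lemma Qdiff_valE q s (t : {t | Qidx I (d := d) q t}) : Qidx I q.+1 s ->
  (Qdiff_val I q s : {ffun _ -> _}) t =
  cdiff I s (val t) * 'X_[lcmset s - lcmset (val t)].
Proof.
case/andP=> cs /eqP card_s; have vs : isvertex I s by case/andP: cs.
have as_ := admissible_Fcrit vs; have sE := critical_eq hI hd cs.
have cF : #|Fcrit I s| = q.+1 by move: card_s; rewrite {1}sE (card_crit_of hI hd as_) => -[].
have /andP[ct /eqP card_t] := valP t.
have F0 : (0 < #|Fcrit I s|)%N by rewrite cF.
have := cdiffE hI hd as_ F0 ct (etrans card_t (esym cF)); rewrite -sE => ->.
pose X := 'X_[lcmset s - lcmset (val t)] : St.
pose A : {ffun {t | Qidx I q t} -> St^o} := \sum_(p in Fcrit I s)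
  ((-1) ^+ frank (Fcrit I s) p * 'X_[pvar p] : St) *: basisv (s :\ bracket I (top s) p.1).
pose B : {ffun {t | Qidx I q t} -> St^o} := \sum_(t : vertex | Qidx I q t)
  (gradient_sum I (s :\ top s) t * 'X_[lcmset s - lcmset t] : St) *: basisv t.
have AE : A t = (\sum_(p in Fcrit I s) (-1) ^+ frank (Fcrit I s) p *
    (crit_of I (Fcrit I s :\ p) (top s) == val t)%:R) * X.
  rewrite /A sum_ffunE mulr_suml; apply: eq_bigr => p pF; rewrite ffun_scaleE basisvE.
  have sp : s :\ bracket I (top s) p.1 = crit_of I (Fcrit I s :\ p) (top s).
    by rewrite {1}sE (crit_of_del hI hd as_ pF).
  rewrite sp eq_sym; case: eqP => [tE|_]; last by rewrite !mulr0 mul0r.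
  have XE : X = 'X_[pvar p] by rewrite /X -tE {1}sE (lcm_sub_del as_ pF).
  by rewrite XE !mulr1.
have BE : B t = gradient_sum I (s :\ top s) (val t) * X.
  rewrite /B sum_ffunE (bigD1 (val t)) /=; last exact: valP t.
  rewrite big1 => [|u /andP[_ /negbTE ut]]; last first.
    by rewrite ffun_scaleE basisvE eq_sym ut mulr0.
  by rewrite addr0 ffun_scaleE basisvE eqxx mulr1.
have -> : Qdiff_val I q s = A - (-1) ^+ q.+1 *: B by [].
rewrite ffun_subE ffun_scaleE AE BE cF [in RHS]exprS mulN1r mulNr.
by rewrite mulrDl mulNr mulrA.
Qed.

(** At most one summand meets a given basis vector: an unchanged generator points to the first sum,
    a changed one to the second, and F' determines the deleted element. *)
Lemma Pdiff_valE q F m (y : {y | Pidx I (d := d) q y}) : admissible I F m -> #|F| = q.+1 ->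
  (Pdiff_val I q (F, m) : {ffun _ -> _}) y =
  cdiff I (crit_of I F m) (crit_of I (val y).1 (val y).2) *
    'X_[lcmset (crit_of I F m) - lcmset (crit_of I (val y).1 (val y).2)].
Proof.
move=> aFm cF; have F0 : (0 < #|F|)%N by rewrite cF.
case: y => -[F' m'] yP; have /andP[/= aF' /eqP cF'] := yP; set y := exist _ _ _.
pose X F1 m1 : St := 'X_[lcmset (crit_of I F m) - lcmset (crit_of I F1 m1)].
have -> : (Pdiff_val I q (F, m) : {ffun _ -> _}) y =
    \sum_(p in F) (-1) ^+ frank F p * X (F :\ p) m * ((F', m') == (F :\ p, m))%:R -
    \sum_(p in F | admissible I (F :\ p) (bracket I m p.1))
      (-1) ^+ frank F p * X (F :\ p) (bracket I m p.1) *
      ((F', m') == (F :\ p, bracket I m p.1))%:R.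
  pose A : {ffun {y | Pidx I q y} -> St^o} := \sum_(p in F)
    ((-1) ^+ frank F p * 'X_[pvar p] : St) *: basisv (F :\ p, m).
  pose B : {ffun {y | Pidx I q y} -> St^o} :=
    \sum_(p in F | admissible I (F :\ p) (bracket I m p.1))
      ((-1) ^+ frank F p * 'X_[pvar p + bpol d m - bpol d (bracket I m p.1)] : St)
        *: basisv (F :\ p, bracket I m p.1).
  have -> : Pdiff_val I q (F, m) = A - B by [].
  rewrite ffun_subE; congr (_ - _).
    rewrite /A sum_ffunE; apply: eq_bigr => p pF.
    by rewrite ffun_scaleE basisvE /X (lcm_sub_del aFm pF).
  rewrite /B sum_ffunE; apply: eq_bigr => p /andP[pF ap].
  by rewrite ffun_scaleE basisvE /X (lcm_sub_bracket aFm pF ap).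
have bm p : p \in F -> (m == bracket I m p.1) = false.
  by move=> pF; rewrite eq_sym; apply/negbTE/(bracket_neq hI hd aFm pF).
have DD p p' : p \in F -> (F :\ p == F :\ p') = (p == p').
  move=> pF; apply/eqP/eqP => [E|->//]; have : p \notin F :\ p' by rewrite -E setD11.
  by rewrite !inE pF andbT negbK => /eqP.
have [/exists_inP[p pF /andP[/eqP FE /eqP mE]]|no1] :=
  boolP [exists p in F, (F' == F :\ p) && (m' == m)].
  subst F' m' => /=; rewrite (cdiff_del hI hd aFm pF) (bigD1 p) //= eqxx mulr1.
  rewrite !big1 ?addr0 ?subr0 // => q' /andP[q'F ?].
    by rewrite xpair_eqE bm // andbF mulr0.
  by rewrite xpair_eqE DD // eq_sym (negbTE (_ : q' != p)) // mulr0.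
rewrite (big1 _ (fun p => p \in F)) => [|p pF]; last first.
  rewrite xpair_eqE; have -> : (F' == F :\ p) && (m' == m) = false; last by rewrite mulr0.
  by apply: contraNF no1 => H; apply/exists_inP; exists p.
rewrite sub0r; have [/exists_inP[p pF /and3P[ap /eqP FE /eqP mE]]|no2] :=
  boolP [exists p in F, [&& admissible I (F :\ p) (bracket I m p.1),
    F' == F :\ p & m' == bracket I m p.1]].
  subst F' m' => /=; rewrite (cdiff_bracket hI hd aFm pF ap) (bigD1 p) /=; last by rewrite pF.
  rewrite eqxx mulr1 big1 ?addr0 ?mulNr // => q' /andP[/andP[q'F _] qp].
  by rewrite xpair_eqE DD // eq_sym (negbTE qp) mulr0.
rewrite big1 ?oppr0 => [|p /andP[pF ap]]; last first.
  rewrite xpair_eqE.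
  have -> : (F' == F :\ p) && (m' == bracket I m p.1) = false; last by rewrite mulr0.
  by apply: contraNF no2 => H; apply/exists_inP; exists p; rewrite ?ap.
rewrite /=; have -> : cdiff I (crit_of I F m) (crit_of I F' m') = 0 :> St; last by rewrite mul0r.
apply/eqP; apply: contraT => nz.
have card_y : #|crit_of I F' m'| = #|F| by rewrite (card_crit_of hI hd aF') cF' cF.
have [p pF [/eqP|[ap /eqP]]] := cdiff_neq0 hI hd aFm F0 (critical_crit_of hI hd aF') card_y nz.
  rewrite (crit_of_eq hI hd aF' (adm_del aFm p)) => H.
  by case/exists_inP: no1; exists p.
rewrite (crit_of_eq hI hd aF' ap) => H.
by case/exists_inP: no2; exists p; rewrite ?ap.
Qed.

Lemma QtoP_diff q (x : Qmod I d q.+1) :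
  QtoP I d q (Qdiff I d q x) = Pdiff I d q.+1 (QtoP I d q.+1 x).
Proof.
apply/ffunP => y; rewrite QtoPE /Qdiff /Pdiff !linextE.
rewrite [RHS](reindex (@adm_idx q.+1)) /=; last by exists (@crit_idx q.+1) => ? _; rewrite (adm_idxK, crit_idxK).
apply: eq_bigr => s _; rewrite QtoPE adm_idxK; congr (_ * _).
have /andP[cs /eqP card_s] := valP s; have vs : isvertex I (val s) by case/andP: cs.
have as_ := admissible_Fcrit vs; have sE := critical_eq hI hd cs.
have cF : #|Fcrit I (val s)| = q.+1.
  by move: card_s; rewrite {1}sE (card_crit_of hI hd as_) => -[].
by rewrite Qdiff_valE ?(valP s) // (Pdiff_valE _ as_ cF) -sE.
Qed.

Lemma Qdiff_Qdiff q (x : Qmod I d q.+2) : Qdiff I d q (Qdiff I d q.+1 x) = 0.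
Proof.
apply/ffunP => y; rewrite /Qdiff linextE ffunE.
transitivity (\sum_(s : {s | Qidx I q.+2 s}) (x s : St) *
   \sum_(t : {t | Qidx I q.+1 t}) (cdiff I (val s) (val t) * cdiff I (val t) (val y)) *
      'X_[lcmset (val s) - lcmset (val y)]).
  under eq_bigr => t _ do rewrite linextE mulr_suml.
  rewrite exchange_big /=; apply: eq_bigr => s _; rewrite big_distrr /=.
  apply: eq_bigr => t _; rewrite (Qdiff_valE t (valP s)) (Qdiff_valE y (valP t)).
  rewrite -mulrA; congr (_ * _).
  (* Quotients of lcms multiply when they are exact, which holds once both coefficients are
     nonzero. *)
  have [->|nz1] := eqVneq (cdiff I (val s) (val t)) 0; first by rewrite !mul0r.
  have [->|nz2] := eqVneq (cdiff I (val t) (val y)) 0; first by rewrite mulr0 !mul0r mulr0.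
  rewrite mulrACA -mpolyXD; congr (_ * 'X_[_]).
  have := cdiff_lset nz1; have := cdiff_lset nz2; rewrite -!sqfree_le -!lcmsetE.
  move=> /mnm_lepP yt /mnm_lepP ts; apply/mnmP => j; rewrite !(mnmDE, mnmBE).
  by rewrite addnBA // subnK.
apply: big1 => s _; rewrite -mulr_suml.
have -> : \sum_(t : {t | Qidx I q.+1 t}) cdiff I (val s) (val t) * cdiff I (val t) (val y) = 0 :> St;
  last by rewrite mul0r mulr0.
have /andP[cs /eqP card_s] := valP s; have vs : isvertex I (val s) by case/andP: cs.
have /andP[cy /eqP card_y] := valP y.
rewrite -[RHS](cdiff_cdiff hI hd vs card_s cy card_y).
by rewrite [RHS](sum_sig (Qidx I (d := d) q.+1) (fun u => cdiff I (val s) u * cdiff I u (val y))).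

Qed.
End Isomorphism.

Theorem theorem5p13 (k : fieldType) (n d : nat) (I : {pred {mpoly k[n]}})
    (hI : borel_fixed I)
    (hd : forall m : 'X_{1..n}, mingen I m -> (mdeg m <= d)%N) :
  @is_complex_iso {mpoly k[n * d]}
    (Qmod I d) (fun q => Pmod I d q.+1)
    (Qdiff I d) (fun q => Pdiff I d q.+1)
    (QtoP I d).
Proof.
split.
- exact: Qdiff_Qdiff hI hd.
- move=> q x; have [g _ gK] := QtoP_bij hI hd q.+2.
  by rewrite -(gK x) -(QtoP_diff hI hd) -(QtoP_diff hI hd) (Qdiff_Qdiff hI hd) linear0.
- exact: QtoP_bij hI hd.
- exact: QtoP_diff hI hd.
Qed.
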